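(* Let $\mathcal{H}=\{H_n\}_{n\ge 0}$ and $\mathcal{K}=\{K_n\}_{n\ge 0}$ be quadratic subproduct systems of finite-dimensional Hilbert spaces. Then the Fock space $\mathcal{F}(\mathcal{H}\star\mathcal{K})$ of their free product is unitarily isomorphic to the Hilbert space free product $\mathcal{F}(\mathcal{H})\ast\mathcal{F}(\mathcal{K})$ of the Fock spaces.
   Context: A standard subproduct system of finite-dimensional Hilbert spaces is a sequence $\mathcal{H}=\{H_n\}_{n\ge 0}$ of finite-dimensional Hilbert spaces with $H_0=\mathbb{C}$ and $H_{m+n}\subseteq H_m\otimes H_n$ for all $m,n$ (so $H_n\subseteq H_1^{\otimes n}$), the structure maps being the inclusions. Given $H_1$ and a subspace $H_2\subseteq H_1\otimes H_1$, the maximal subproduct system with these prescribed fibres is defined by $H_n=\bigcap_{i+j=n,\ i,j\ge 1}H_i\otimes H_j$ for $n\ge 3$. A standard subproduct system is quadratic if it is the maximal subproduct system with prescribed fibres $\mathbb{C},H_1,H_2=R^\perp$ for some subspace $R\subseteq H_1\otimes H_1$. Free product: for quadratic $\mathcal{H},\mathcal{K}$, $\mathcal{H}\star\mathcal{K}$ is the maximal subproduct system with prescribed fibres $(H\star K)_1=H_1\oplus K_1$ and $(H\star K)_2=(H_2^\perp\oplus K_2^\perp)^\perp$, where $H_2^\perp\subseteq H_1\otimes H_1$ and $K_2^\perp\subseteq K_1\otimes K_1$ are viewed as subspaces of $(H_1\oplus K_1)^{\otimes 2}$. The Fock space is the Hilbert space direct sum $\mathcal{F}(\mathcal{H})=\bigoplus_{n\ge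 0}H_n$, with distinguished unit vector the vacuum vector $\omega_0=1\in H_0=\mathbb{C}$. The free product of two Hilbert spaces $(E_1,\xi_1)$, $(E_2,\xi_2)$ with distinguished unit vectors is $\mathbb{C}\xi_0\oplus\bigoplus_{p\ge 1}\bigoplus_{i\in D_p}E_{i_1}^\circ\otimes\cdots\otimes E_{i_p}^\circ$, where $\xi_0$ is a unit vector, $E_i^\circ$ is the orthocomplement of $\mathbb{C}\xi_i$ in $E_i$, and $D_p=\{(i_1,\dots,i_p): i_j\in\{1,2\},\ i_j\ne i_{j+1}\}$. *)

(* Defs.v *)
From HB Require Import structures.
From mathcomp Require Import all_boot all_order all_algebra.
From mathcomp Require Import sesquilinear complex.
From mathcomp Require Import all_classical all_reals all_analysis.

Set Implicit Arguments.
Unset Strict Implicit.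
Unset Printing Implicit Defensive.

Import Order.TTheory GRing.Theory Num.Theory.
Import numFieldNormedType.Exports.

Local Open Scope classical_set_scope.
Local Open Scope ring_scope.
Local Open Scope complex_scope.

(* The inner product is linear in its first argument, as for every            *)
(* [{dot _ for _}]; [hilbert_normE] says that the complete norm of the space  *)
(* is the one induced by the inner product.                                   *)
Record hilbert (R : realType) := Hilbert {
  hilbert_sort :> completeNormedModType R[i];
  hilbert_dot : {dot hilbert_sort for @Num.conj R[i]};
  hilbert_normE : forall x : hilbert_sort, `|x| ^+ 2 = hilbert_dot x x
}.

Notation "''[' x , y ]" := (hilbert_dot _ x y)
  (format "''[' x ,  y ]") : ring_scope.

Section Subsets.
Context {R : realType}.
Implicit Types E F : hilbert R.

Definition is_subspace E (A : set E) : Prop :=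
  A 0 /\ forall (a : R[i]) x y, A x -> A y -> A (a *: x + y).

Definition linear_span E (A : set E) : set E :=
  [set z | exists (n : nat) (c : 'I_n -> R[i]) (v : 'I_n -> E),
     (forall k, A (v k)) /\ z = \sum_(k < n) c k *: v k].

(* the closed linear span is the whole space *)
Definition total E (A : set E) : Prop := closure (linear_span A) = setT.

Definition orthocompl E (A : set E) : set E :=
  [set x | forall y, A y -> '[x, y] = 0].

Definition finite_dim E : Prop :=
  exists (n : nat) (v : 'I_n -> E), linear_span (range v) = setT.

Definition unitarily_isomorphic E F : Prop :=
  exists U : {linear E -> F},
    (forall x y, '[U x, U y] = '[x, y]) /\ (forall z, exists x, U x = z).

End Subsets.

(* Hilbert space direct sum of the subspaces [S i] of [E i]: a Hilbert space  *)
(* with isometric copies of the [S i] that are mutually orthogonal and whose  *)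
(* union is total.  The values of [hsum_inj i] outside [S i] are irrelevant.  *)
Record hilbert_sum (R : realType) (I : Type) (E : I -> hilbert R)
    (S : forall i, set (E i)) := HilbertSum {
  hsum_space :> hilbert R;
  hsum_inj : forall i, E i -> hsum_space;
  hsum_linear : forall i (a : R[i]) (x y : E i), S i x -> S i y ->
    hsum_inj (a *: x + y) = a *: hsum_inj x + hsum_inj y;
  hsum_isometry : forall i (x y : E i), S i x -> S i y ->
    '[hsum_inj x, hsum_inj y] = '[x, y];
  hsum_ortho : forall i j (x : E i) (y : E j), i <> j -> S i x -> S j y ->
    '[hsum_inj x, hsum_inj y] = 0;
  hsum_total : total [set z | exists i (x : E i), S i x /\ z = hsum_inj x]
}.
Arguments hilbert_sum {R I} E S.
Arguments hsum_inj {R I E S} h {i} x.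

(* Hilbert space tensor product of the subspaces [S 0], ..., [S (p - 1)]; the *)
(* values of [tens] outside the product of the [S k] are irrelevant.  For     *)
(* p = 0 this is the field of scalars, with unit vector the empty tensor.     *)
Record hilbert_tensor (R : realType) (p : nat) (E : 'I_p -> hilbert R)
    (S : forall k, set (E k)) := HilbertTensor {
  tens_space :> hilbert R;
  tens : (forall k, E k) -> tens_space;
  tens_multilinear : forall (k : 'I_p) (a : R[i]) (x y z : forall k, E k),
    (forall l, S l (x l)) -> (forall l, S l (y l)) ->
    (forall l, l != k -> z l = x l /\ y l = x l) ->
    z k = a *: x k + y k ->
    tens z = a *: tens x + tens y;
  tens_dot : forall x y : forall k, E k,
    (forall k, S k (x k)) -> (forall k, S k (y k)) ->
    '[tens x, tens y] = \prod_(k < p) '[x k, y k];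
  tens_total : total [set z | exists x : forall k, E k,
    (forall k, S k (x k)) /\ z = tens x]
}.

Arguments hilbert_tensor {R p} E S.

Section SubproductSystems.
Context {R : realType}.

Definition tensor_powers (V : hilbert R) : Type :=
  forall n, hilbert_tensor (fun _ : 'I_n => V) (fun _ => setT).

Definition pure (V : hilbert R) (T : tensor_powers V) (n : nat)
    (w : nat -> V) : T n := tens (T n) (fun k : 'I_n => w k).

(* For n = i + j: [z] is the tensor product of [x] and [y], the tensor        *)
(* product of the i-th and j-th tensor powers being identified with the n-th  *)
(* one by concatenation of pure tensors (see [tmul_pure]).  As pure tensors   *)
(* are total, the inner products with them determine [z].                     *)
Definition is_tmul (V : hilbert R) (T : tensor_powers V) (i j n : nat)
    (x : T i) (y : T j) (z : T n) : Prop :=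
  forall w : nat -> V, '[z, pure T n w] =
    '[x, pure T i w] * '[y, pure T j (fun k => w (i + k)%N)].

(* the subspace A (x) B of the n-th tensor power, n = i + j, V being finite   *)
(* dimensional                                                                *)
Definition subtensor (V : hilbert R) (T : tensor_powers V) (i j n : nat)
    (A : set (T i)) (B : set (T j)) : set (T n) :=
  linear_span [set z | exists x y, A x /\ B y /\ is_tmul x y z].

Global Arguments subtensor {V T i j} n A B.

Definition standard_subproduct (V : hilbert R) (T : tensor_powers V)
    (H : forall n, set (T n)) : Prop :=
  [/\ forall n, is_subspace (H n), H 0%N = setT, H 1%N = setT &
      forall m n, H (m + n)%N `<=` subtensor (m + n)%N (H m) (H n)].

(* The fuel [N] only serves the recursion; see [max_fiber_ge3]. *)
Fixpoint max_fiber_rec (V : hilbert R) (T : tensor_powers V) (H2 : set (T 2))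
    (N n : nat) : set (T n) :=
  if N is N'.+1 then
    match n return set (T n) with
    | 0%N | 1%N => setT
    | 2%N => H2
    | m.+3 => [set z | forall i j, (0 < i)%N -> (0 < j)%N ->
        (i + j = m.+3)%N ->
        subtensor m.+3 (@max_fiber_rec V T H2 N' i) (@max_fiber_rec V T H2 N' j) z]
    end
  else setT.
Global Arguments max_fiber_rec {V T} H2 N n.

Definition max_fiber (V : hilbert R) (T : tensor_powers V) (H2 : set (T 2))
    (n : nat) : set (T n) := max_fiber_rec H2 n n.
Global Arguments max_fiber {V T} H2 n.

Definition quadratic (V : hilbert R) (T : tensor_powers V)
    (H : forall n, set (T n)) : Prop :=
  standard_subproduct H /\
  exists Rel : set (T 2), is_subspace Rel /\
    forall n, H n = max_fiber (orthocompl Rel) n.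

(* image of [A] under f (x) f; in finite dimension every element of [T 2] is  *)
(* a finite sum of pure tensors                                               *)
Definition tensor_image2 (V W : hilbert R) (T : tensor_powers V)
    (T' : tensor_powers W) (f : V -> W) (A : set (T 2)) : set (T' 2) :=
  [set z | exists (n : nat) (c : 'I_n -> R[i]) (u : 'I_n -> nat -> V),
     A (\sum_(k < n) c k *: pure T 2 (u k)) /\
     z = \sum_(k < n) c k *: pure T' 2 (f \o u k)].

Definition oplus (V W : hilbert R) : Type :=
  hilbert_sum (fun b : bool => if b then V else W) (fun _ => setT).

Definition oplus_inl (V W : hilbert R) (VW : oplus V W) : V -> VW :=
  @hsum_inj R bool _ _ VW true.

Definition oplus_inr (V W : hilbert R) (VW : oplus V W) : W -> VW :=
  @hsum_inj R bool _ _ VW false.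

Definition free_fiber2 (V W : hilbert R) (VW : oplus V W)
    (TV : tensor_powers V) (TW : tensor_powers W) (T : tensor_powers VW)
    (H : forall n, set (TV n)) (K : forall n, set (TW n)) : set (T 2) :=
  orthocompl [set z | exists x y,
    tensor_image2 (@oplus_inl V W VW) (orthocompl (H 2)) x /\
    tensor_image2 (@oplus_inr V W VW) (orthocompl (K 2)) y /\ z = x + y].
Global Arguments free_fiber2 {V W VW TV TW} T H K.

Definition free_subproduct (V W : hilbert R) (VW : oplus V W)
    (TV : tensor_powers V) (TW : tensor_powers W) (T : tensor_powers VW)
    (H : forall n, set (TV n)) (K : forall n, set (TW n)) :
    forall n, set (T n) :=
  max_fiber (free_fiber2 T H K).
Global Arguments free_subproduct {V W VW TV TW} T H K n.

Definition fock (V : hilbert R) (T : tensor_powers V)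
    (H : forall n, set (T n)) : Type :=
  hilbert_sum (fun n : nat => T n) H.

End SubproductSystems.

Record pointed_hilbert (R : realType) := PointedHilbert {
  ph_space :> hilbert R;
  ph_vec : ph_space;
  ph_unit : '[ph_vec, ph_vec] = 1
}.

Definition alternating (s : seq bool) : bool := sorted (fun a b => a != b) s.

(* The summand of the empty word is the empty tensor product, i.e. the line   *)
(* spanned by the distinguished vector of the free product.                   *)
Record hilbert_free_product (R : realType) (E : bool -> pointed_hilbert R) :=
  HilbertFreeProduct {
  hfp_tensor : forall s : seq bool,
    hilbert_tensor (fun k : 'I_(size s) => E (nth true s k))
                   (fun k => orthocompl [set ph_vec (E (nth true s k))]);
  hfp_space :> hilbert_sum (fun s : {s : seq bool | alternating s} =>
                  hfp_tensor (sval s)) (fun _ => setT)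
}.

Section Facts.
Context {R : realType}.

Lemma tmul_pure (V : hilbert R) (T : tensor_powers V) (i j : nat)
    (u v : nat -> V) :
  is_tmul (pure T i u) (pure T j v)
    (pure T (i + j) (fun k => if (k < i)%N then u k else v (k - i)%N)).
Proof.
move=> w; rewrite /pure !tens_dot // big_split_ord /=.
congr (_ * _); apply: eq_bigr => k _; first by rewrite ltn_ord.
by rewrite ltnNge leq_addr /= addKn.
Qed.

Lemma tmul_inj (V : hilbert R) (T : tensor_powers V) (i j n : nat)
    (x : T i) (y : T j) (z z' : T n) : is_tmul x y z -> is_tmul x y z' ->
  forall w, '[z - z', pure T n w] = 0.
Proof. by move=> xyz xyz' w; rewrite linearBl /= xyz xyz' subrr. Qed.

Lemma max_fiber_recE (V : hilbert R) (T : tensor_powers V) (H2 : set (T 2))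
    (N M n : nat) : (n <= N)%N -> (n <= M)%N ->
  max_fiber_rec H2 N n = max_fiber_rec H2 M n.
Proof.
elim: N M n => [|N IH] [|M] [|[|[|n]]] //= nN nM.
apply/seteqP; split=> z /= Hz i j i0 j0 ij; move: (Hz i j i0 j0 ij);
  have iN : (i < n.+3)%N by rewrite -ij -addn1 leq_add2l.
all: have jN : (j < n.+3)%N by rewrite -ij -add1n leq_add2r.
all: rewrite (IH M i) ?(IH M j) //.
all: by [exact: leq_trans (nN : (n.+2 <= N)%N) | exact: leq_trans (nM : (n.+2 <= M)%N)].
Qed.

Lemma max_fiber0 (V : hilbert R) (T : tensor_powers V) (H2 : set (T 2)) :
  max_fiber H2 0 = setT.
Proof. by []. Qed.

Lemma max_fiber1 (V : hilbert R) (T : tensor_powers V) (H2 : set (T 2)) :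
  max_fiber H2 1 = setT.
Proof. by []. Qed.

Lemma max_fiber2 (V : hilbert R) (T : tensor_powers V) (H2 : set (T 2)) :
  max_fiber H2 2 = H2.
Proof. by []. Qed.

Lemma max_fiber_ge3 (V : hilbert R) (T : tensor_powers V) (H2 : set (T 2))
    (n : nat) : (3 <= n)%N ->
  max_fiber H2 n = [set z | forall i j, (0 < i)%N -> (0 < j)%N ->
    (i + j = n)%N -> subtensor n (max_fiber H2 i) (max_fiber H2 j) z].
Proof.
case: n => [|[|[|n]]] // _.
apply/seteqP; split=> z Hz i j i0 j0 ij; move: (Hz i j i0 j0 ij);
  have iN : (i < n.+3)%N by rewrite -ij -addn1 leq_add2l.
all: have jN : (j < n.+3)%N by rewrite -ij -add1n leq_add2r.
all: have Ei := @max_fiber_recE V T H2 n.+2 i i iN (leqnn i).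
all: have Ej := @max_fiber_recE V T H2 n.+2 j j jN (leqnn j).
all: by rewrite /max_fiber -Ei -Ej.
Qed.

Lemma vacuum_unit (V : hilbert R) (T : tensor_powers V)
    (H : forall n, set (T n)) (quadH : quadratic H) (F : fock H) :
  '[hsum_inj F (pure T 0 (fun _ => 0)), hsum_inj F (pure T 0 (fun _ => 0))]
    = 1.
Proof.
have H0 x : H 0%N x by have [[_ -> _ _] _] := quadH.
rewrite (hsum_isometry F) // /pure tens_dot // big_ord0 //.
Qed.

End Facts.

(* The vacuum is 1 in H_0 = C, i.e. the empty tensor. *)
Definition pointed_fock (R : realType) (V : hilbert R) (T : tensor_powers V)
    (H : forall n, set (T n)) (quadH : quadratic H) (F : fock H) :
    pointed_hilbert R :=
  PointedHilbert (vacuum_unit quadH F).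

(* Main.v *)
Require Import Defs.
From HB Require Import structures.
From mathcomp Require Import all_boot all_order all_algebra.
From mathcomp Require Import sesquilinear complex.
From mathcomp Require Import all_classical all_reals all_analysis.

Set Implicit Arguments.
Unset Strict Implicit.
Unset Printing Implicit Defensive.

Import Order.TTheory GRing.Theory Num.Theory.
Import numFieldNormedType.Exports.

Local Open Scope classical_set_scope.
Local Open Scope ring_scope.
Local Open Scope complex_scope.

(** Both spaces have an orthonormal basis indexed by the same set, namely the
    alternating words l of letters (b, (m, i)), where b tells the two systems
    apart and i numbers an orthonormal basis of the fibre of degree m + 1 of
    the system b. Two total families with the same Gram matrix determine a
    unitary ([unitary_of_gram]), so nothing more is needed.

    In the free product of the Fock spaces the word l is sent to the
    elementary tensor of the basis vectors that it lists. These vectors form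
    an orthonormal basis of the complement of the vacuum in each Fock space
    ([fock_basis_gram], [fock_basis_total]), hence their alternating tensors
    form one of the free product ([free_basis_gram], [free_basis_total]).

    In the Fock space of the free product system the word l is sent to the
    concatenation of the same tensors. To see that these concatenations span
    the fibres, a tensor of degree n is described by its coefficients on the
    words of length n over an alphabet that consists of an orthonormal basis
    of each space of degree one. In these terms the maximal fibre is given by a
    local condition: all slices in two consecutive positions belong to the
    fibre of degree two ([max_fiberP]). For the free product this condition
    constrains only the pairs of positions of the same colour
    ([free_fiber2P]). A tensor in the fibre therefore splits according to the
    colour pattern of the words, and on a given pattern its slices along a
    maximal run of one colour belong to the fibre of that system. Expanding
    the slices along the first run in the chosen basis and arguing by
    induction on the length of the pattern expresses the tensor by
    concatenations ([gen_pattern_span], [gen_span]). Concatenations with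
    different colour patterns have disjoint supports, and those with the same
    pattern have the product of the inner products of their factors as inner
    product ([gen_gram]). *)

(** * Subspaces and closed spans *)

Section HilbertBasics.
Context {R : realType}.
Implicit Types E F : hilbert R.

Lemma dotC E (x y : E) : '[x, y] = Num.conj '[y, x].
Proof. by rewrite hermC expr0 mul1r. Qed.

Lemma dotDZl E (a : R[i]) (x y z : E) :
  '[a *: x + y, z] = a * '[x, z] + '[y, z].
Proof. exact: linearPl. Qed.

Lemma dotDZr E (a : R[i]) (x y z : E) :
  '[z, a *: x + y] = Num.conj a * '[z, x] + '[z, y].
Proof. exact: linearPr. Qed.

Lemma dotZl E (a : R[i]) (x z : E) : '[a *: x, z] = a * '[x, z].
Proof. exact: linearZl_LR. Qed.

Lemma dotZr E (a : R[i]) (x z : E) : '[z, a *: x] = Num.conj a * '[z, x].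
Proof. exact: linearZr_LR. Qed.

Lemma dot0l E (z : E) : '[0, z] = 0.
Proof. exact: linear0l. Qed.

Lemma dot0r E (z : E) : '[z, 0] = 0.
Proof. exact: linear0r. Qed.

Lemma dotDl E (x y z : E) : '[x + y, z] = '[x, z] + '[y, z].
Proof. exact: linearDl. Qed.

Lemma dotDr E (x y z : E) : '[z, x + y] = '[z, x] + '[z, y].
Proof. exact: linearDr. Qed.

Lemma dotBl E (x y z : E) : '[x - y, z] = '[x, z] - '[y, z].
Proof. exact: linearBl. Qed.

Lemma dotBr E (x y z : E) : '[z, x - y] = '[z, x] - '[z, y].
Proof. exact: linearBr. Qed.

Lemma dot_suml E I (r : seq I) (P : pred I) (u : I -> E) z :
  '[\sum_(i <- r | P i) u i, z] = \sum_(i <- r | P i) '[u i, z].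
Proof. exact: linear_sumlz. Qed.

Lemma dot_sumr E I (r : seq I) (P : pred I) (u : I -> E) z :
  '[z, \sum_(i <- r | P i) u i] = \sum_(i <- r | P i) '[z, u i].
Proof. exact: linear_sumr. Qed.

Lemma eq_norm E F (x : E) (y : F) : '[x, x] = '[y, y] -> `|x| = `|y|.
Proof.
by rewrite -!hilbert_normE => /eqP; rewrite eqrXn2 ?normr_ge0 // => /eqP.
Qed.

Lemma closureP E (A : set E) x :
  closure A x <-> forall e : R[i], 0 < e -> exists2 y, A y & `|x - y| < e.
Proof.
split=> [Ax e e0|Ax B /nbhs_ballP[e /= e0 eB]].
  have /Ax[y [Ay]] : nbhs x (ball x e) by exact: nbhsx_ballx.
  by rewrite -ball_normE; exists y.
have [y Ay xy] := Ax e e0; exists y; split=> //.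
by apply: eB; rewrite -ball_normE.
Qed.

Lemma small_eq0 (x c : R[i]) : 0 <= x -> 0 <= c ->
  (forall e, 0 < e -> x <= c * e) -> x = 0.
Proof.
move=> x0 c0 xe; apply/eqP/negPn/negP => xn0.
have xp : 0 < x by rewrite lt_def xn0.
have c1 : 0 < c + 1 by rewrite ltr_wpDl.
have c2 : 0 < (c + 1) * 2 by rewrite mulr_gt0.
have := xe (x / ((c + 1) * 2)) (divr_gt0 xp c2).
rewrite mulrA ler_pdivlMr // mulrC ler_pM2r // => h.
have : c + 1 <= c by apply: le_trans h; rewrite mulr_natr mulr2n lerDl ltW.
by rewrite gerDl ler10.
Qed.

(** The closed linear span. *)
Definition closed_span E (A : set E) : set E := closure (linear_span A).

Lemma subspace_sum E (S : set E) I (r : seq I) (P : pred I) (c : I -> R[i]) u :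
  is_subspace S -> (forall i, P i -> S (u i)) ->
  S (\sum_(i <- r | P i) c i *: u i).
Proof.
move=> [S0 Slin] Su; elim: r => [|i r IH]; first by rewrite big_nil.
by rewrite big_cons; case: ifP => // Pi; apply: Slin => //; exact: Su.
Qed.

Lemma subspaceZ E (S : set E) a x : is_subspace S -> S x -> S (a *: x).
Proof. by move=> [S0 Slin] Sx; rewrite -[_ *: _]addr0; exact: Slin. Qed.

Lemma subspaceB E (S : set E) x y : is_subspace S -> S x -> S y -> S (x - y).
Proof.
by move=> [S0 Slin] Sx Sy; rewrite addrC -scaleN1r; exact: Slin.
Qed.

Lemma linear_span_min E (A S : set E) :
  is_subspace S -> A `<=` S -> linear_span A `<=` S.
Proof.
by move=> Ss AS z [n [c [v [Av ->]]]]; apply: subspace_sum => // i _; apply: AS.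
Qed.

Lemma sub_linear_span E (A : set E) : A `<=` linear_span A.
Proof.
move=> x Ax; exists 1%N, (fun _ => 1), (fun _ => x); split=> //.
by rewrite big_ord1 scale1r.
Qed.

Lemma linear_span_subspace E (A : set E) : is_subspace (linear_span A).
Proof.
split=> [|a x y [n [c [v [Av ->]]]] [m [d [w [Aw ->]]]]].
  by exists 0%N, (fun _ => 0), (fun _ => 0); split=> [[]|] //; rewrite big_ord0.
exists (n + m)%N, (fun k => match fintype.split k with inl i => a * c i | inr j => d j end),
  (fun k => match fintype.split k with inl i => v i | inr j => w j end); split.
  by move=> k; case: fintype.split.
rewrite big_split_ord /= scaler_sumr; congr (_ + _); apply: eq_bigr => k _.
  by rewrite -[lshift _ _]/(unsplit (inl k)) unsplitK scalerA.
by rewrite -[rshift _ _]/(unsplit (inr k)) unsplitK.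
Qed.

Lemma closure_subspace E (S : set E) : is_subspace S -> is_subspace (closure S).
Proof.
move=> [S0 Slin]; split=> [|a x y /closureP Ax /closureP Ay].
  exact: subset_closure.
apply/closureP => e e0.
have a1 : 0 < `|a| + 1 by rewrite ltr_wpDl.
have [x' Sx' xx'] := Ax (e / 2 / (`|a| + 1)) (divr_gt0 (divr_gt0 e0 (ltr0Sn _ 1)) a1).
have [y' Sy' yy'] := Ay (e / 2) (divr_gt0 e0 (ltr0Sn _ 1)).
exists (a *: x' + y'); first exact: Slin.
have -> : a *: x + y - (a *: x' + y') = a *: (x - x') + (y - y').
  by rewrite scalerBr opprD addrACA.
apply: le_lt_trans (ler_normD _ _) _; rewrite normrZ [e]splitr ler_ltD //.
move: xx'; rewrite ltr_pdivlMr // => xx'.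
by apply: le_trans (ltW xx'); rewrite mulrC ler_wpM2l // lerDl ler01.
Qed.

Lemma closed_span_subspace E (A : set E) : is_subspace (closed_span A).
Proof. exact/closure_subspace/linear_span_subspace. Qed.

Lemma sub_closed_span E (A : set E) : A `<=` closed_span A.
Proof. by apply: subset_trans (@subset_closure _ _); exact: sub_linear_span. Qed.

Lemma closed_span_closed E (A : set E) x :
  closure (closed_span A) x -> closed_span A x.
Proof.
by have /closure_id <- : closed (closed_span A) by exact: closed_closure.
Qed.

(** A linear map that is bounded on a subspace carries closed spans into
    closed spans. *)
Lemma closed_span_image E F (S : set E) (f : E -> F) (c : R[i])
    (A : set E) (B : set F) :
  is_subspace S -> 0 <= c ->
  (forall a x y, S x -> S y -> f (a *: x + y) = a *: f x + f y) ->
  (forall x, S x -> `|f x| <= c * `|x|) ->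
  A `<=` S -> (forall x, A x -> closed_span B (f x)) ->
  forall x, S x -> closed_span A x -> closed_span B (f x).
Proof.
move=> Ss c0 flin fc AS fA x Sx /closureP Ax; have [S0 Slin] := Ss.
have [B0 Blin] := closed_span_subspace B.
have f0 : f 0 = 0.
  by have := flin (-1) 0 0 S0 S0; rewrite scaler0 addr0 scaleN1r addNr.
have sAS : linear_span A `<=` S `&` [set y | closed_span B (f y)].
  apply: linear_span_min => [|y Ay]; last by split; [exact: AS|exact: fA].
  split=> [|a y z [Sy By] [Sz Bz]]; first by split=> //=; rewrite f0.
  by split; [exact: Slin|rewrite /= flin //; exact: Blin].
apply: closed_span_closed; apply/closureP => e e0.
have c1 : 0 < c + 1 by rewrite ltr_wpDl.
have [y /sAS[Sy By] xy] := Ax (e / (c + 1)) (divr_gt0 e0 c1).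
exists (f y) => //.
have -> : f x - f y = f (x - y).
  by rewrite [x - y]addrC -(scaleN1r y) flin // scaleN1r addrC.
apply: le_lt_trans (fc _ (subspaceB Ss Sx Sy)) _.
move: xy; rewrite ltr_pdivlMr //; apply: le_lt_trans.
by rewrite mulrC ler_wpM2l // lerDl ler01.
Qed.

(** ** Finite Parseval systems *)

(** Bessel's inequality as an equality. The family u is orthonormal except
    that u i is 0 when D i fails. *)
Lemma bessel_eq E (I : eqType) (r : seq I) (D : pred I) (u : I -> E) x :
  uniq r ->
  {in r &, forall i j, '[u i, u j] = ((i == j) && D i)%:R} ->
  let y := x - \sum_(i <- r) '[x, u i] *: u i in
  '[y, y] = '[x, x] - \sum_(i <- r) '[x, u i] * Num.conj '[x, u i].
Proof.
move=> ur gram /=; set o := \sum_(i <- r) _; set s := \sum_(i <- r) _.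
have xo : '[x, o] = s.
  by rewrite dot_sumr; apply: eq_bigr => i _; rewrite dotZr mulrC.
have uo i : i \in r -> '[u i, o] = Num.conj '[x, u i].
  move=> ir; rewrite dot_sumr (bigD1_seq i) //= big1_seq => [|j /andP[ji jr]].
    rewrite dotZr gram // eqxx addr0; case: (boolP (D i)) => [_|Di]; first by rewrite mulr1.
    suff -> : u i = 0 by rewrite dot0r conjC0 mul0r.
    by apply/eqP; rewrite -(dnorm_eq0 (hilbert_dot E)) gram // (negPf Di) andbF.
  by rewrite dotZr gram // eq_sym (negPf ji) mulr0.
have oo : '[o, o] = s.
  rewrite {1}/o dot_suml; apply: eq_big_seq => i ir.
  by rewrite dotZl uo.
have sC : Num.conj s = s.
  by rewrite rmorph_sum; apply: eq_bigr => i _; rewrite rmorphM /= conjCK mulrC.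
by rewrite dotBl !dotBr oo xo (dotC o) xo sC subrr subr0.
Qed.

(** Parseval's equality on a total set gives the expansion of every vector. *)
Lemma parseval_expansion E (I : eqType) (r : seq I) (D : pred I) (u : I -> E)
    (A : set E) :
  uniq r ->
  {in r &, forall i j, '[u i, u j] = ((i == j) && D i)%:R} ->
  Defs.total A ->
  (forall x, A x -> '[x, x] = \sum_(i <- r) '[x, u i] * Num.conj '[x, u i]) ->
  forall x, x = \sum_(i <- r) '[x, u i] *: u i.
Proof.
move=> ur gram totA pA x.
pose p (y : E) := y - \sum_(i <- r) '[y, u i] *: u i.
have plin a y z : p (a *: y + z) = a *: p y + p z.
  rewrite /p scalerBr addrACA -opprD; congr (_ - _).
  rewrite scaler_sumr -big_split; apply: eq_bigr => i _ /=.
  by rewrite dotDZl scalerDl scalerA.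
have ple y : `|p y| <= `|y|.
  rewrite -(@ler_pXn2r _ 2) ?nnegrE // !hilbert_normE (bessel_eq _ ur gram) //.
  by rewrite lerBlDr lerDl; apply: sumr_ge0 => i _; exact: mul_conjC_ge0.
have p0 y : linear_span A y -> p y = 0.
  move: y; apply: (@linear_span_min E A [set y | p y = 0]) => [|y Ay /=].
    split=> [|a y z /= y0 z0]; last by rewrite plin y0 z0 scaler0 addr0.
    by rewrite /= /p big1 ?subr0 // => i _; rewrite dot0l scale0r.
  apply/eqP; rewrite -(dnorm_eq0 (hilbert_dot E)) (bessel_eq _ ur gram) pA //.
  by rewrite subrr.
apply/eqP; rewrite -subr_eq0 -/(p x) -normr_eq0; apply/eqP.
apply: (@small_eq0 _ 1) => // e e0; rewrite mul1r.
have /closureP/(_ e e0)[y Ay xy] : closure (linear_span A) x by rewrite totA.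
have -> : p x = p (x - y).
  by rewrite [x - y]addrC -(scaleN1r y) plin (p0 _ Ay) scaler0 add0r.
exact: le_trans (ple _) (ltW xy).
Qed.

(** A subspace of a finite-dimensional space has a finite orthonormal basis.
    The vectors u i with d <= i are irrelevant. *)
Lemma ex_onb E N (v : 'I_N -> E) (S : set E) :
  is_subspace S -> S `<=` linear_span (range v) ->
  exists (d : nat) (u : nat -> E), [/\ forall i, (i < d)%N -> S (u i),
    forall i j, (i < d)%N -> (j < d)%N -> '[u i, u j] = (i == j)%:R &
    forall x, S x -> x = \sum_(i < d) '[x, u i] *: u i].
Proof.
move=> Ss Sv.
pose good d := exists u : nat -> E, (forall i, (i < d)%N -> S (u i)) /\
    forall i j, (i < d)%N -> (j < d)%N -> '[u i, u j] = (i == j)%:R.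
have good0 : `[< good 0%N >] by apply/asboolP; exists (fun _ => 0); split.
(* with u i = \sum_k c i k *: v k, orthonormality of u makes the matrix c
   right invertible *)
have goodN d : `[< good d >] -> (d <= N)%N.
  move=> /asboolP[u [Su gu]].
  have /choice[c cP] (i : 'I_d) : exists c : 'I_N -> R[i],
      u i = \sum_k c k *: v k.
    have [n [b [w [Aw ->]]]] := Sv _ (Su i (ltn_ord i)).
    have /choice[g gP] (k : 'I_n) : exists m, v m = w k.
      by have [m _ mk] := Aw k; exists m.
    exists (fun m => \sum_(k < n | g k == m) b k).
    rewrite (eq_bigr (fun k => b k *: v (g k))) => [|k _]; last by rewrite gP.
    rewrite (partition_big g xpredT) //=; apply: eq_bigr => m _.
    by rewrite scaler_suml; apply: eq_bigr => k /eqP ->.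
  apply: (@mulmx1_min _ _ _ (\matrix_(i, k) c i k)
    (\matrix_(k, j) '[v k, u (j : 'I_d)])).
  apply/matrixP => i j; rewrite !mxE.
  rewrite -[RHS](gu _ _ (ltn_ord i) (ltn_ord j)) [in RHS]cP dot_suml.
  by apply: eq_bigr => k _; rewrite !mxE dotZl.
(* an orthonormal family of maximal length spans S: otherwise the normalized
   residual y of some x in S would extend it *)
case: (ex_maxnP (ex_intro _ 0%N good0) goodN) => d /asboolP[u [Su gu]] dmax.
exists d, u; split=> // x Sx; apply/eqP; rewrite -subr_eq0; apply/negPn/negP.
set y := x - _ => y0.
have Sy : S y by apply: subspaceB => //; apply: subspace_sum => // i _; exact: Su.
have yu (i : 'I_d) : '[y, u i] = 0.
  rewrite dotBl dot_suml (bigD1 i) //= dotZl gu // eqxx mulr1.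
  rewrite big1 ?addr0 ?subrr // => j ji; rewrite dotZl gu //.
  by rewrite val_eqE (negPf ji) mulr0.
have y0' : `|y| != 0 by rewrite normr_eq0.
pose w i := if (i < d)%N then u i else `|y|^-1 *: y.
suff : (d.+1 <= d)%N by rewrite ltnn.
apply: dmax; apply/asboolP; exists w; split=> [i _|i j].
  by rewrite /w; case: ifP => id; [exact: Su|exact: subspaceZ].
rewrite /w !ltnS => ild jld.
have uy i0 : (i0 < d)%N -> '[u i0, y] = 0.
  by move=> id; rewrite dotC (yu (Ordinal id)) conjC0.
have yu' i0 : (i0 < d)%N -> '[y, u i0] = 0.
  by move=> id; exact: (yu (Ordinal id)).
case: (ltnP i d) => id; case: (ltnP j d) => jd.
- exact: gu.
- by rewrite dotZr uy // mulr0 ltn_eqF // (leq_trans id).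
- by rewrite dotZl yu' // mulr0 gtn_eqF // (leq_trans jd).
have -> : i = j by apply/eqP; rewrite eqn_leq (leq_trans ild jd) (leq_trans jld id).
rewrite eqxx dotZl dotZr -hilbert_normE.
rewrite (CrealP _) ?rpredV ?normr_real // expr2 mulrA mulrACA.
by rewrite mulrA mulfK // mulVf.
Qed.

End HilbertBasics.

(** * Unitaries from Gram matrices *)

Section Extension.
Context {R : realType} (E F : hilbert R) (I : Type) (f : I -> E) (g : I -> F).
Hypothesis gram : forall i j, '[f i, f j] = '[g i, g j].

(** Pairs of vectors with the same coefficients on f and g: the graph of the
    isometry between the linear spans. *)
Definition graph_span (x : E) (y : F) : Prop :=
  exists s : seq (R[i] * I),
    x = \sum_(p <- s) p.1 *: f p.2 /\ y = \sum_(p <- s) p.1 *: g p.2.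

Lemma graph_span_lin a x y x' y' :
  graph_span x y -> graph_span x' y' ->
  graph_span (a *: x + x') (a *: y + y').
Proof.
move=> [s [-> ->]] [t [-> ->]].
exists ([seq (a * p.1, p.2) | p <- s] ++ t).
by split; rewrite big_cat big_map scaler_sumr /=; congr (_ + _);
  apply: eq_bigr => p _; rewrite scalerA.
Qed.

Lemma graph_span_norm x y : graph_span x y -> `|x| = `|y|.
Proof.
move=> [s [-> ->]]; apply: eq_norm; rewrite !dot_suml; apply: eq_bigr => p _.
rewrite !dot_sumr; apply: eq_bigr => q _.
by rewrite !dotZl !dotZr gram.
Qed.

(** The closure of [graph_span], which is the graph of the unitary. *)
Definition graph_closure (x : E) (y : F) : Prop := forall e : R[i], 0 < e ->
  exists x' y', [/\ graph_span x' y', `|x - x'| < e & `|y - y'| < e].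

Lemma graph_closure_lin a x y x' y' :
  graph_closure x y -> graph_closure x' y' ->
  graph_closure (a *: x + x') (a *: y + y').
Proof.
move=> xy xy' e e0.
have a1 : 0 < `|a| + 1 by rewrite ltr_wpDl.
have e2 : 0 < e / 2 by rewrite divr_gt0.
have [u [v [uv xu yv]]] := xy (e / 2 / (`|a| + 1)) (divr_gt0 e2 a1).
have [u' [v' [uv' xu' yv']]] := xy' (e / 2) e2.
exists (a *: u + u'), (a *: v + v'); split; first exact: graph_span_lin.
- have -> : a *: x + x' - (a *: u + u') = a *: (x - u) + (x' - u').
    by rewrite scalerBr opprD addrACA.
  apply: le_lt_trans (ler_normD _ _) _; rewrite normrZ [e]splitr ler_ltD //.
  move: xu; rewrite ltr_pdivlMr // => xu.
  by apply: le_trans (ltW xu); rewrite mulrC ler_wpM2l // lerDl ler01.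
- have -> : a *: y + y' - (a *: v + v') = a *: (y - v) + (y' - v').
    by rewrite scalerBr opprD addrACA.
  apply: le_lt_trans (ler_normD _ _) _; rewrite normrZ [e]splitr ler_ltD //.
  move: yv; rewrite ltr_pdivlMr // => yv.
  by apply: le_trans (ltW yv); rewrite mulrC ler_wpM2l // lerDl ler01.
Qed.

Lemma graph_closure_norm x y : graph_closure x y -> `|x| = `|y|.
Proof.
move=> xy; apply/eqP; rewrite -subr_eq0 -normr_eq0; apply/eqP.
apply: (@small_eq0 _ _ 2) => // e e0.
have [u [v [uv xu yv]]] := xy e e0.
have -> : `|x| - `|y| = (`|x| - `|u|) + (`|v| - `|y|).
  by rewrite (graph_span_norm uv) addrA subrK.
apply: le_trans (ler_normD _ _) _; rewrite mulr_natl mulr2n lerD //.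
  exact: le_trans (ler_dist_dist _ _) (ltW xu).
rewrite distrC; exact: le_trans (ler_dist_dist _ _) (ltW yv).
Qed.

Lemma graph_closure_uniq x y y' :
  graph_closure x y -> graph_closure x y' -> y = y'.
Proof.
move=> xy xy'; have := graph_closure_lin (-1) xy xy'.
rewrite !scaleN1r addNr => /graph_closure_norm; rewrite normr0 => /esym/eqP.
by rewrite normr_eq0 addrC subr_eq0 => /eqP.
Qed.

(** By completeness the closed graph is defined everywhere: the second
    components of the pairs whose first component is close to x form a Cauchy
    filter. *)
Lemma graph_closure_ex : Defs.total (range f) ->
  forall x, exists y, graph_closure x y.
Proof.
move=> totf x.
pose B (e : R[i]) := [set y | exists2 x', graph_span x' y & `|x - x'| < e].
have Bne e : 0 < e -> B e !=set0.
  have /closureP H : closure (linear_span (range f)) x by rewrite totf.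
  move=> /H[x' [n [c [v [vf ->]]]] xx'].
  have /choice[h hP] (k : 'I_n) : exists i, f i = v k.
    by have [i _ <-] := vf k; exists i.
  exists (\sum_(k < n) c k *: g (h k)), (\sum_(k < n) c k *: v k) => //.
  exists [seq (c k, h k) | k <- index_enum 'I_n].
  by split; rewrite big_map //=; apply: eq_bigr => k _; rewrite hP.
pose G := filter_from [set e : R[i] | 0 < e] B.
have GG : Filter G.
  apply: filter_from_filter; first by exists 1 => /=.
  move=> a b /= a0 b0.
  have [ab|ba] : a <= b \/ b <= a.
    by apply/orP; apply: real_leVge; exact: gtr0_real.
  - exists a => // y [u uy xu]; split; exists u => //; exact: lt_le_trans ab.
  - exists b => // y [u uy xu]; split; exists u => //; exact: lt_le_trans ba.
have PG : ProperFilter G by apply: filter_from_proper.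
have : cauchy G.
  apply: cauchy_exP => e e0.
  have e2 : 0 < e / 2 by rewrite divr_gt0.
  have [y [u uy xu]] := Bne _ e2.
  exists y, (e / 2) => // z [w wz xw]; rewrite -ball_normE /=.
  have := graph_span_lin (-1) wz uy; rewrite !scaleN1r.
  move=> /graph_span_norm; rewrite [- z + _]addrC => <-.
  have -> : - w + u = (x - w) + - (x - u).
    by rewrite opprB [x - w]addrC addrACA subrr addr0.
  by apply: le_lt_trans (ler_normD _ _) _; rewrite normrN [e]splitr ltrD.
move=> /cauchy_cvg cG; have [y yG] : exists y, G --> (y : F).
  by exists (lim G).
exists y => e e0.
have Gy : G (ball y e) by apply: yG; exact: nbhsx_ballx.
have GB : G (B e) by exists e.
have [z [+ [u uz xu]]] := filter_ex (filterI Gy GB).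
by rewrite -ball_normE => yz; exists u, z.
Qed.

End Extension.

Lemma graph_closure_sym (R : realType) (E F : hilbert R) (I : Type)
    (f : I -> E) (g : I -> F) x y :
  graph_closure f g x y -> graph_closure g f y x.
Proof.
move=> xy e e0; have [u [v [[s [us vs]] xu yv]]] := xy e e0.
by exists v, u; split=> //; exists s.
Qed.

(** A linear map that preserves norms preserves inner products. *)
Lemma polarization (R : realType) (E F : hilbert R) (U : {linear E -> F}) :
  (forall x, `|U x| = `|x|) -> forall x y, '[U x, U y] = '[x, y].
Proof.
move=> Un.
have Ud x : '[U x, U x] = '[x, x] by rewrite -!hilbert_normE Un.
have re x y : '[U x, U y] + '[U y, U x] = '[x, y] + '[y, x].
  have := Ud (x + y); rewrite linearD !dotDl !dotDr !Ud.
  by rewrite -!addrA => /addrI; rewrite !addrA => /addIr.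
move=> x y; have h1 := re x y; have := re x ('i *: y).
rewrite linearZ_LR /= !dotZl !dotZr conjCi !mulNr => h2.
have {}h2 : '[U y, U x] - '[U x, U y] = '[y, x] - '[x, y].
  apply: (mulfI (neq0Ci _)); rewrite !mulrBr addrC h2 addrC.
  by [].
have twice (a b : R[i]) : a *+ 2 = (a + b) - (b - a).
  by rewrite opprB addrACA subrr addr0 mulr2n.
have : '[U x, U y] *+ 2 = '[x, y] *+ 2.
  by rewrite (twice _ '[U y, U x]) h1 h2 -twice.
by move/eqP; rewrite eqrMn2r => /eqP.
Qed.

(** Two total families with the same Gram matrix determine a unitary. *)
Theorem unitary_of_gram (R : realType) (E F : hilbert R) (I : Type)
    (f : I -> E) (g : I -> F) :
  (forall i j, '[f i, f j] = '[g i, g j]) ->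
  Defs.total (range f) -> Defs.total (range g) -> unitarily_isomorphic E F.
Proof.
move=> gram totf totg.
have gram' i j : '[g i, g j] = '[f i, f j] by rewrite gram.
have /choice[u uP] := graph_closure_ex gram totf.
have ulin a : {morph u : x y / a *: x + y >-> a *: x + y}.
  move=> x y; apply: (graph_closure_uniq gram (uP _)).
  exact: graph_closure_lin.
pose Um := GRing.isLinear.Build R[i] E F *:%R u ulin.
pose U : {linear E -> F} := HB.pack u Um.
exists U; split.
  by apply: polarization => x; rewrite -(graph_closure_norm gram (uP x)).
move=> z; have [x zx] := graph_closure_ex gram' totg z.
by exists x; apply: (graph_closure_uniq gram (uP _)); exact: graph_closure_sym.
Qed.

(** * Words *)

Section Words.
Context (A : finType).

(** All words of length n over the alphabet A. *)
Fixpoint words (n : nat) : seq (seq A) :=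
  if n is n'.+1 then [seq a :: w | a <- enum A, w <- words n'] else [:: [::]].

Lemma mem_words n w : (w \in words n) = (size w == n).
Proof.
elim: n w => [|n IH] w /=; first by rewrite inE size_eq0.
apply/allpairsP/idP => [[[a v] [/= _ + ->]]|].
  by rewrite IH /= eqSS.
case: w => // a w; rewrite eqSS -IH => wn.
by exists (a, w); rewrite mem_enum.
Qed.

Lemma words_uniq n : uniq (words n).
Proof.
elim: n => //= n IH; apply: allpairs_uniq => //; first exact: enum_uniq.
by move=> [a v] [b w] _ _ /= [-> ->].
Qed.

Lemma sum_wordsS (M : nmodType) n (F : seq A -> M) :
  \sum_(w <- words n.+1) F w = \sum_(a : A) \sum_(w <- words n) F (a :: w).
Proof. by rewrite big_allpairs_dep /= big_enum. Qed.

Lemma sum_words_cat (M : nmodType) m n (F : seq A -> M) :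
  \sum_(w <- words (m + n)) F w =
  \sum_(u <- words m) \sum_(v <- words n) F (u ++ v).
Proof.
elim: m F => [|m IH] F; first by rewrite big_seq1.
by rewrite addSn !sum_wordsS; apply: eq_bigr => a _; rewrite IH.
Qed.

Lemma prod_sum_words (K : comNzRingType) (V : zmodType) (e : A -> V) n
    (G : nat -> V -> K) :
  \prod_(k < n) \sum_(a : A) G k (e a) =
  \sum_(w <- words n) \prod_(k < n) G k (map e w)`_k.
Proof.
elim: n G => [|n IH] G; first by rewrite big_ord0 big_seq1 big_ord0.
rewrite big_ord_recl (IH (fun k => G k.+1)) sum_wordsS big_distrlr /=.
apply: eq_bigr => a _; apply: eq_bigr => w _; by rewrite big_ord_recl.
Qed.

Lemma sum_words_delta (K : pzSemiRingType) (V : lSemiModType K) n (F : seq A -> V) w :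
  size w = n -> \sum_(u <- words n) (u == w)%:R *: F u = F w.
Proof.
move=> wn; rewrite (bigD1_seq w) ?words_uniq ?mem_words ?wn //=.
rewrite eqxx scale1r big1 ?addr0 // => u uw.
by rewrite (negPf uw) scale0r.
Qed.

End Words.

Arguments words A n : simpl never.

(** * Coefficients of tensors *)

Section Frame.
Context {R : realType}.

(** An orthonormal basis of V, indexed by the letters of A that satisfy
    [fdom]; the remaining letters are sent to 0. *)
Record frame (V : hilbert R) (A : finType) := Frame {
  fvec :> A -> V;
  fdom : pred A;
  frame_gram : forall a b, '[fvec a, fvec b] = ((a == b) && fdom a)%:R;
  frame_parseval : forall x : V,
    '[x, x] = \sum_(a : A) '[x, fvec a] * Num.conj '[x, fvec a]
}.

Context (V : hilbert R) (A : finType) (e : frame V A) (T : tensor_powers V).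

(** The tensor product of the basis vectors of the letters of w, a word of
    length n. *)
Definition pword n (w : seq A) : T n := pure T n (nth 0 (map e w)).

(** The coefficient of a tensor of degree n on a word of length n. *)
Definition coef n (z : T n) (w : seq A) : R[i] := '[z, pword n w].

(** The tensor of degree n with the given coefficients; only the values of f
    on the words of length n with all letters in [fdom] matter. *)
Definition of_coef n (f : seq A -> R[i]) : T n :=
  \sum_(w <- words A n) f w *: pword n w.

Lemma pure_eq n (u v : nat -> V) :
  (forall k, (k < n)%N -> u k = v k) -> pure T n u = pure T n v.
Proof. by move=> uv; congr (tens _ _); apply: funext => k; exact: uv. Qed.

Lemma pure_dot n (u v : nat -> V) :
  '[pure T n u, pure T n v] = \prod_(k < n) '[u k, v k].
Proof. by rewrite tens_dot. Qed.

Lemma pword_dot n u v : size u = n -> size v = n ->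
  '[pword n u, pword n v] = ((u == v) && all (fdom e) u)%:R.
Proof.
rewrite /pword pure_dot; elim: n u v => [|n IH] [|a u] [|b v] //=.
  by rewrite big_ord0.
move=> [un] [vn]; rewrite big_ord_recl /= frame_gram IH // -natrM mulnb.
by rewrite eqseq_cons !andbA; congr (_ && _)%:R; rewrite andbAC.
Qed.

Lemma coef_expand n (z : T n) : z = \sum_(w <- words A n) coef z w *: pword n w.
Proof.
move: z; apply: (@parseval_expansion R (T n) (seq A) (words A n)
  (all (fdom e)) (pword n) _ (words_uniq A n) _ (tens_total (T n))).
  by move=> u v; rewrite !mem_words => /eqP un /eqP vn; exact: pword_dot.
(* Parseval's equality for an elementary tensor is the product of the
   equalities for its factors *)
move=> _ [x [_ ->]].
pose w k : V := if insub k is Some i then x i else 0.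
have -> : tens (T n) x = pure T n w.
  congr (tens _ _); apply: funext => k; rewrite /w.
  by case: insubP => [i _ /val_inj <-|]; rewrite ?ltn_ord.
rewrite pure_dot.
under eq_bigr => k _ do rewrite (frame_parseval e).
rewrite (prod_sum_words e n (fun k y => '[w k, y] * Num.conj '[w k, y])).
apply: eq_bigr => u _; rewrite pure_dot rmorph_prod -big_split.
by apply: eq_bigr.
Qed.

Lemma tensor_coefK n (z : T n) : of_coef n (coef z) = z.
Proof. exact/esym/coef_expand. Qed.

Lemma of_coef_ext n f g : (forall w, size w = n -> f w = g w) ->
  of_coef n f = of_coef n g.
Proof.
move=> fg; apply: eq_big_seq => w; rewrite mem_words => /eqP wn.
by rewrite fg.
Qed.

Lemma tensor_coef_inj n (y z : T n) :
  (forall w, size w = n -> coef y w = coef z w) -> y = z.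
Proof. by move=> yz; rewrite -[y]tensor_coefK -[z]tensor_coefK; exact: of_coef_ext. Qed.

Lemma tensor_coef_lin n a (y z : T n) w : coef (a *: y + z) w = a * coef y w + coef z w.
Proof. exact: dotDZl. Qed.

Lemma tensor_coef_sum n I (r : seq I) (P : pred I) (u : I -> T n) w :
  coef (\sum_(i <- r | P i) u i) w = \sum_(i <- r | P i) coef (u i) w.
Proof. exact: dot_suml. Qed.

Lemma tensor_coefZ n a (z : T n) w : coef (a *: z) w = a * coef z w.
Proof. exact: dotZl. Qed.

Lemma of_coef_lin n a f g :
  of_coef n (fun w => a * f w + g w) = a *: of_coef n f + of_coef n g.
Proof.
rewrite scaler_sumr -big_split; apply: eq_bigr => w _ /=.
by rewrite scalerDl scalerA.
Qed.

Lemma of_coefZ n a f : of_coef n (fun w => a * f w) = a *: of_coef n f.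
Proof. by rewrite scaler_sumr; apply: eq_bigr => w _ /=; rewrite scalerA. Qed.

Lemma of_coef_sum n I (r : seq I) (P : pred I) (f : I -> seq A -> R[i]) :
  of_coef n (fun w => \sum_(i <- r | P i) f i w) =
  \sum_(i <- r | P i) of_coef n (f i).
Proof.
by rewrite exchange_big; apply: eq_bigr => w _ /=; rewrite scaler_suml.
Qed.

Lemma of_coef0 n f : (forall w, size w = n -> f w = 0) -> of_coef n f = 0.
Proof.
move=> f0; rewrite (of_coef_ext (g := fun _ => 0)) //.
by apply: big1 => w _; rewrite scale0r.
Qed.

Lemma pword_off n w : size w = n -> ~~ all (fdom e) w -> pword n w = 0.
Proof.
move=> wn wD; apply/eqP; rewrite -(dnorm_eq0 (hilbert_dot (T n))).
by rewrite pword_dot // (negPf wD) andbF.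
Qed.

Lemma coef_off n (z : T n) w : size w = n -> ~~ all (fdom e) w -> coef z w = 0.
Proof. by move=> wn wD; rewrite /coef pword_off // dot0r. Qed.

Lemma of_coefK_dom n f w : size w = n -> all (fdom e) w ->
  coef (of_coef n f) w = f w.
Proof.
move=> wn wD; rewrite tensor_coef_sum -[RHS](sum_words_delta (K := R[i]) (V := R[i]^o) f wn).
apply: eq_big_seq => u; rewrite mem_words => /eqP un.
rewrite tensor_coefZ /coef pword_dot // mulrC; case: eqP => [->|]; first by rewrite wD.
by rewrite /= scale0r mul0r.
Qed.

Lemma of_coefK n f w :
  (forall u, size u = n -> ~~ all (fdom e) u -> f u = 0) -> size w = n ->
  coef (of_coef n f) w = f w.
Proof.
move=> f0 wn; case: (boolP (all (fdom e) w)) => wD; first exact: of_coefK_dom.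
by rewrite coef_off // f0.
Qed.

Lemma dot_coef n (y z : T n) :
  '[y, z] = \sum_(w <- words A n) coef y w * Num.conj (coef z w).
Proof.
rewrite {1}[z]coef_expand dot_sumr; apply: eq_bigr => w _.
by rewrite dotZr mulrC.
Qed.

Lemma tensor_onb n (X : set (T n)) : is_subspace X ->
  exists (d : nat) (u : nat -> T n), [/\ forall i, (i < d)%N -> X (u i),
    forall i j, (i < d)%N -> (j < d)%N -> '[u i, u j] = (i == j)%:R &
    forall x, X x -> x = \sum_(i < d) '[x, u i] *: u i].
Proof.
move=> Xs; pose N := size (words A n).
apply: (@ex_onb R (T n) N (fun k => pword n (nth [::] (words A n) k))) => //.
move=> z _; exists N, (fun k => coef z (nth [::] (words A n) k)),
  (fun k => pword n (nth [::] (words A n) k)).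
split=> [k|]; first by exists k.
by rewrite {1}[z]coef_expand (big_nth [::]) big_mkord.
Qed.

(** ** Concatenation *)

Lemma tmul_coef i j (x : T i) (y : T j) (z : T (i + j)%N) :
  is_tmul x y z <-> forall u v, size u = i -> size v = j ->
    coef z (u ++ v) = coef x u * coef y v.
Proof.
split=> [xyz u v ui vj|xyz w].
  rewrite /coef /pword xyz; congr (_ * _);
    congr (hilbert_dot _ _ _); apply: pure_eq => k ki.
    by rewrite map_cat nth_cat size_map ui ki.
  by rewrite map_cat nth_cat size_map ui ltnNge leq_addr /= addKn.
rewrite {1}[z]coef_expand {1}[x]coef_expand {1}[y]coef_expand !dot_suml.
rewrite sum_words_cat big_distrlr /=.
apply: eq_big_seq => u; rewrite mem_words => /eqP ui.
apply: eq_big_seq => v; rewrite mem_words => /eqP vj.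
rewrite !dotZl xyz // mulrACA; congr (_ * _).
rewrite /pword !pure_dot big_split_ord /=; congr (_ * _);
  apply: eq_bigr => k _; rewrite map_cat nth_cat size_map ui.
  by rewrite ltn_ord.
by rewrite ltnNge leq_addr /= addKn.
Qed.

(** An element of a tensor product belongs to X (x) Y exactly when all its
    slices in either direction belong to X and to Y. *)
Lemma subtensorP i j n (X : set (T i)) (Y : set (T j)) (z : T n) :
  (i + j = n)%N -> is_subspace X -> is_subspace Y ->
  subtensor n X Y z <->
  (forall v, size v = j -> X (of_coef i (fun u => coef z (u ++ v)))) /\
  (forall u, size u = i -> Y (of_coef j (fun v => coef z (u ++ v)))).
Proof.
move=> ijn; subst n => Xs Ys; split.
  move: z; apply: linear_span_min.
    have [X0 Xl] := Xs; have [Y0 Yl] := Ys.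
    split=> [|a y z [yX yY] [zX zY]].
      by split=> w _; rewrite of_coef0 // => u _; exact: dot0l.
    split=> w ws; rewrite (of_coef_ext (fun u _ => tensor_coef_lin a y z _)) of_coef_lin.
      by apply: Xl; [exact: yX|exact: zX].
    by apply: Yl; [exact: yY|exact: zY].
  move=> z [x [y [Xx [Yy /tmul_coef xyz]]]]; split=> w ws.
    rewrite (of_coef_ext (g := fun u => coef y w * coef x u)).
      by rewrite of_coefZ tensor_coefK; exact: subspaceZ.
    by move=> u ui; rewrite xyz // mulrC.
  rewrite (of_coef_ext (g := fun v => coef x w * coef y v)).
    by rewrite of_coefZ tensor_coefK; exact: subspaceZ.
  by move=> v vj; rewrite xyz.
(* expand the slices of z in an orthonormal basis b of X: z is the sum of
   the b k (x) c k, where c k is a combination of slices *)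
move=> [zX zY]; have [d [b [Xb gb eb]]] := tensor_onb Xs.
pose c k : T j := \sum_(u <- words A i)
  Num.conj (coef (b k) u) *: of_coef j (fun v => coef z (u ++ v)).
pose t k : T (i + j)%N := of_coef (i + j)
  (fun w => coef (b k) (take i w) * coef (c k) (drop i w)).
have tE k u v : size u = i -> size v = j ->
    coef (t k) (u ++ v) = coef (b k) u * coef (c k) v.
  move=> ui vj; rewrite of_coefK ?size_cat ?ui ?vj //; last first.
    move=> w wij wD; move: (wD).
    rewrite -{1}(cat_take_drop i w) all_cat negb_and => /orP[|] h.
      by rewrite coef_off ?mul0r // size_takel // wij leq_addr.
    by rewrite [X in _ * X]coef_off ?mulr0 // size_drop wij addKn.
  by rewrite take_size_cat // drop_size_cat.
have -> : z = \sum_(k < d) t k.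
  apply: tensor_coef_inj => w wij; rewrite -(cat_take_drop i w).
  have ui : size (take i w) = i by rewrite size_takel // wij leq_addr.
  have vj : size (drop i w) = j by rewrite size_drop wij addKn.
  move: (take i w) (drop i w) ui vj => u v ui vj.
  rewrite tensor_coef_sum.
  have off g : size g = i -> ~~ all (fdom e) g -> coef z (g ++ v) = 0.
    move=> gi gD; rewrite coef_off ?size_cat ?gi ?vj //.
    by rewrite all_cat negb_and gD.
  rewrite -(of_coefK off ui) [in LHS](eb _ (zX v vj)) tensor_coef_sum.
  apply: eq_bigr => k _; rewrite tE // tensor_coefZ mulrC; congr (_ * _).
  rewrite dot_coef tensor_coef_sum; apply: eq_big_seq => g.
  rewrite mem_words => /eqP gi; rewrite tensor_coefZ (of_coefK off gi) mulrC.
  rewrite of_coefK // => h hj hD; rewrite coef_off ?size_cat ?gi ?hj //.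
  by rewrite all_cat negb_and hD orbT.
have := linear_span_subspace [set z0 : T (i + j)%N |
  exists x y, X x /\ Y y /\ is_tmul x y z0].
move=> ss; rewrite (eq_bigr (fun k => 1 *: t (k : 'I_d))); last by move=> k _; rewrite scale1r.
apply: subspace_sum => // k _; apply: sub_linear_span.
exists (b k), (c k); split; first exact: Xb.
split; last by apply/tmul_coef; exact: tE.
rewrite /c big_seq; apply: subspace_sum => // u.
by rewrite mem_words => /eqP ui; exact: zY.
Qed.

End Frame.


(** * Maximal fibres *)

Section MaximalFibres.
Context {R : realType} (V : hilbert R) (A : finType) (e : frame V A)
  (T : tensor_powers V).

Lemma of_coef_ext_dom n f g :
  (forall w, size w = n -> all (fdom e) w -> f w = g w) ->
  of_coef e T n f = of_coef e T n g.
Proof.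
move=> fg; apply: eq_big_seq => w; rewrite mem_words => /eqP wn.
case: (boolP (all (fdom e) w)) => wD; first by rewrite fg.
by rewrite pword_off // !scaler0.
Qed.

Lemma of_coef0_dom n f :
  (forall w, size w = n -> all (fdom e) w -> f w = 0) -> of_coef e T n f = 0.
Proof.
move=> f0; rewrite (of_coef_ext_dom (g := fun _ => 0)) //; exact: of_coef0.
Qed.

(** The degree two slice of a function on words, at the position that is
    preceded by u and followed by v. *)
Definition window (f : seq A -> R[i]) (u v : seq A) : T 2 :=
  of_coef e T 2 (fun w => f (u ++ w ++ v)).

Lemma window_fibre_subspace (H2 : set (T 2)) n : is_subspace H2 ->
  is_subspace [set z : T n | forall u v, (size u + 2 + size v = n)%N ->
    H2 (window (coef e z) u v)].
Proof.
move=> [H0 Hl]; split=> [u v _|a y z yH zH u v uv] /=.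
  by rewrite /window of_coef0 // => w _; exact: dot0l.
rewrite /window (of_coef_ext _ _ (fun w _ => tensor_coef_lin e a y z _)) of_coef_lin.
by apply: Hl; [exact: yH|exact: zH].
Qed.

(** The maximal fibre consists of the tensors whose degree two slices, at all
    positions, belong to the prescribed fibre. *)
Lemma max_fiberP (H2 : set (T 2)) : is_subspace H2 ->
  forall n (z : T n), max_fiber H2 n z <->
    forall u v, (size u + 2 + size v = n)%N -> H2 (window (coef e z) u v).
Proof.
move=> Hs n; elim/ltn_ind: n => n IH z.
case: (ltnP n 3) => n3.
  case: n n3 z {IH} => [|[|[|//]]] _ z.
  - by split=> // _ u v /eqP; rewrite addnAC addn2.
  - by split=> // _ u v /eqP; rewrite addnAC addn2.
  rewrite max_fiber2; have wz : window (coef e z) [::] [::] = z.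
    rewrite -[RHS](tensor_coefK e); apply: of_coef_ext => w _.
    by rewrite /= cats0.
  split=> [Hz [|a u] [|b v]|/(_ [::] [::])]; rewrite ?wz; last by apply.
  - by [].
  - by move=> /eqP; rewrite addnAC addn2 !eqSS addn_eq0 ?andbF.
  - by move=> /eqP; rewrite addnAC addn2 !eqSS addn_eq0 ?andbF.
  - by move=> /eqP; rewrite addnAC addn2 !eqSS addn_eq0 ?andbF.
rewrite max_fiber_ge3 //.
have IHs i : (i < n)%N -> max_fiber H2 i = [set z : T i | forall u v,
    (size u + 2 + size v = i)%N -> H2 (window (coef e z) u v)].
  by move=> /IH iP; apply/seteqP; split=> y /iP.
have subP i j : (0 < i)%N -> (0 < j)%N -> (i + j = n)%N ->
    subtensor n (max_fiber H2 i) (max_fiber H2 j) z <->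
    (forall v, size v = j -> forall u' v', (size u' + 2 + size v' = i)%N ->
       H2 (window (coef e z) u' (v' ++ v))) /\
    (forall u, size u = i -> forall u' v', (size u' + 2 + size v' = j)%N ->
       H2 (window (coef e z) (u ++ u') v')).
  move=> i0 j0 ijn.
  have iln : (i < n)%N by rewrite -ijn -addn1 leq_add2l.
  have jln : (j < n)%N by rewrite -ijn -add1n leq_add2r.
  rewrite (IHs i iln) (IHs j jln).
  have slice k (f : seq A -> R[i]) u' v' : (size u' + 2 + size v' = k)%N ->
      (forall w, size w = k -> ~~ all (fdom e) w -> f w = 0) ->
      window (coef e (of_coef e T k f)) u' v' = window f u' v'.
    move=> sz f0; apply: of_coef_ext => w w2; rewrite of_coefK //.
    by rewrite !size_cat w2 addnA.
  have zl v : size v = j -> forall w, size w = i -> ~~ all (fdom e) w ->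
      coef e z (w ++ v) = 0.
    move=> vj w wi wD; rewrite coef_off ?size_cat ?wi ?vj //.
    by rewrite all_cat negb_and wD.
  have zr u : size u = i -> forall w, size w = j -> ~~ all (fdom e) w ->
      coef e z (u ++ w) = 0.
    move=> ui w wj wD; rewrite coef_off ?size_cat ?ui ?wj //.
    by rewrite all_cat negb_and wD orbT.
  have wl u' v' v : window (fun w => coef e z (w ++ v)) u' v' =
      window (coef e z) u' (v' ++ v).
    by apply: of_coef_ext => w _; rewrite -!catA.
  have wr u u' v' : window (fun w => coef e z (u ++ w)) u' v' =
      window (coef e z) (u ++ u') v'.
    by apply: of_coef_ext => w _; rewrite -!catA.
  apply: (iff_trans (subtensorP e z ijn
    (window_fibre_subspace i Hs) (window_fibre_subspace j Hs))).
  split=> -[h1 h2]; split=> w ws u' v' sz.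
  - by have := h1 w ws u' v' sz; rewrite slice ?wl //; exact: zl.
  - by have := h2 w ws u' v' sz; rewrite slice ?wr //; exact: zr.
  - by rewrite slice ?wl //; [exact: h1|exact: zl].
  - by rewrite slice ?wr //; [exact: h2|exact: zr].
split=> [zH [|a u] v|zH i j i0 j0 ijn]; last first.
  apply/subP => //; split=> w ws u' v' sz; apply: zH.
    by rewrite size_cat addnA sz ws.
  by rewrite size_cat ws -!addnA [(size u' + _)%N]addnA sz.
- rewrite /= !addSn -add1n => sz.
  have n0 : (0 < size u + 2 + size v)%N by rewrite addnAC addn2.
  have [_ h] := (subP _ _ (ltn0Sn 0) n0 sz).1 (zH _ _ (ltn0Sn 0) n0 sz).
  exact: (h [:: a] (erefl _) u v).
- case/lastP: v => [|v b] /= sz; first by rewrite -sz in n3.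
  move: sz; rewrite size_rcons addnS -addn1 => sz.
  have n0 : (0 < 2 + size v)%N by [].
  have [h _] := (subP _ _ n0 (ltn0Sn 0) sz).1 (zH _ _ n0 (ltn0Sn 0) sz).
  by rewrite -cats1; exact: (h [:: b] (erefl _) [::] v).
Qed.

End MaximalFibres.

Lemma orthocompl_subspace (R : realType) (E : hilbert R) (S : set E) :
  is_subspace (orthocompl S).
Proof.
split=> [y _|a x y xS yS z Sz]; first exact: dot0l.
by rewrite dotDZl xS // yS // mulr0 addr0.
Qed.

(** Orthogonality to the image of a space of relations under f (x) f is a
    condition on the coefficients with letters in the domain of f. *)
Lemma tensor_image2_ortho (R : realType) (V W : hilbert R) (A : finType)
    (fr : frame V A) (e : frame W A) (T : tensor_powers V)
    (T' : tensor_powers W) (f : V -> W) (Rel : set (T 2)) (z : T' 2) :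
  (forall a v, '[e a, f v] = '[fr a, v]) ->
  (forall y, tensor_image2 f (orthocompl (orthocompl Rel)) y -> '[z, y] = 0) <->
  orthocompl Rel (of_coef fr T 2 (coef e z)).
Proof.
move=> ef.
(* the map z |-> of_coef fr (coef e z) is adjoint to f (x) f *)
have adj u : '[of_coef fr T 2 (coef e z), pure T 2 u] = '[z, pure T' 2 (f \o u)].
  rewrite [in RHS](coef_expand e z) !dot_suml; apply: eq_big_seq => w.
  rewrite mem_words => /eqP w2; rewrite !dotZl /pword !pure_dot.
  congr (_ * _); apply: eq_bigr => k _ /=.
  have kw : (k < size w)%N by rewrite w2.
  case: w w2 kw => // a w _ kw.
  by rewrite !(nth_map a) // ef.
have adjs n (c : 'I_n -> R[i]) u :
    '[of_coef fr T 2 (coef e z), \sum_(k < n) c k *: pure T 2 (u k)] =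
    '[z, \sum_(k < n) c k *: pure T' 2 (f \o u k)].
  by rewrite !dot_sumr; apply: eq_bigr => k _; rewrite !dotZr adj.
split=> [zH r rR|zH _ [n [c [u [cu ->]]]]].
  pose N := size (words A 2).
  pose u (k : 'I_N) := nth 0 (map fr (nth [::] (words A 2) k)).
  have rE : r = \sum_(k < N) coef fr r (nth [::] (words A 2) k) *: pure T 2 (u k).
    by rewrite {1}(coef_expand fr r) (big_nth [::]) big_mkord.
  rewrite rE adjs; apply: zH.
  exists N, (fun k => coef fr r (nth [::] (words A 2) k)), u; split=> //.
  by rewrite -rE => y yR; rewrite dotC yR // conjC0.
by rewrite -adjs dotC cu // conjC0.
Qed.


(** * Fibres of the free product *)

(** A letter (b, (m, i)) stands for the i-th basis vector of the fibre of
    degree m + 1 of the system number b. *)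
Definition letter : Type := bool * (nat * nat).

(** The degree of the tensor denoted by a letter. *)
Definition letter_deg (x : letter) : nat := x.2.1.+1.

(** The total degree of the letters of l. *)
Definition word_deg (l : seq letter) : nat := sumn (map letter_deg l).

(** The colour pattern of the words that support the generator of l. *)
Definition colours (l : seq letter) : seq bool :=
  flatten [seq nseq (letter_deg x) x.1 | x <- l].

Lemma size_colours l : size (colours l) = word_deg l.
Proof.
rewrite size_flatten /shape -map_comp; congr sumn; apply: eq_map => x /=.
by rewrite size_nseq.
Qed.

Lemma alternating_cons x l :
  Defs.alternating (map fst (x :: l)) =
  (ohead (colours l) != Some x.1) && Defs.alternating (map fst l).
Proof. by case: l => [|y l] //=; rewrite eq_sym. Qed.

Lemma nseq_cat_inj (b : bool) m m' c c' :
  ohead c != Some b -> ohead c' != Some b ->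
  nseq m b ++ c = nseq m' b ++ c' -> m = m' /\ c = c'.
Proof.
move=> cb cb'; elim: m m' => [|m IH] [|m'] //=.
- by move=> cE; move: cb; rewrite cE eqxx.
- by move=> cE; move: cb'; rewrite -cE eqxx.
by move=> [/IH[-> ->]].
Qed.

Lemma first_run (c : seq bool) : c != [::] ->
  exists b m c', c = nseq m.+1 b ++ c' /\ ohead c' != Some b.
Proof.
elim: c => // b [|b' c] IH _; first by exists b, 0%N, [::].
have [b1 [m [c' [cE cb]]]] := IH isT.
have [eb|nb] := eqVneq b b1.
  by exists b1, m.+1, c'; rewrite cE eb.
by exists b, 0%N, (b' :: c); split=> //; case: cE => -> _; rewrite eq_sym.
Qed.

(* In the two sections on the free product, M is the sequence of its fibres
   and ME describes them by the slices in two consecutive positions; the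
   vectors beta b n i, for i < d b n, form an orthonormal basis of H b n, the
   values for larger i being irrelevant. The frame fr b of the system b uses
   the letters of colour b in the alphabet of the frame e of the sum. *)
Section FreeFibres.
Context {R : realType} (W : hilbert R) (A : finType) (e : frame W A)
  (T : tensor_powers W) (V : bool -> hilbert R)
  (TV : forall b, tensor_powers (V b)) (fr : forall b, frame (V b) A)
  (col : A -> bool) (H : forall b n, set (TV b n)) (M : forall n, set (T n)).
Arguments H : clear implicits.
Arguments M : clear implicits.
Hypothesis fdom_e : forall a, fdom e a.
Hypothesis fdom_fr : forall b a, fdom (fr b) a = (col a == b).
Hypothesis H2s : forall b, is_subspace (H b 2%N).
Hypothesis HE : forall b n, H b n = max_fiber (H b 2%N) n.
Hypothesis ME : forall n z, M n z <->
  forall u v, (size u + 2 + size v = n)%N ->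
  forall b, H b 2%N (window (fr b) (TV b) (coef e z) u v).

Context (d : bool -> nat -> nat) (beta : forall b n, nat -> TV b n).
Hypothesis beta_fibre : forall b n i, (i < d b n)%N -> H b n (beta b n i).
Hypothesis beta_gram : forall b n i j, (i < d b n)%N -> (j < d b n)%N ->
  '[beta b n i, beta b n j] = (i == j)%:R.
Hypothesis beta_expand : forall b n x, H b n x ->
  x = \sum_(i < d b n) '[x, beta b n i] *: beta b n i.

Lemma all_fdom_fr b w : all (fdom (fr b)) w = all (pred1 b) (map col w).
Proof. by rewrite all_map; apply: eq_all => a /=; rewrite fdom_fr. Qed.

Lemma map_col_fdom b w : all (fdom (fr b)) w -> map col w = nseq (size w) b.
Proof. by rewrite all_fdom_fr => /all_pred1P; rewrite size_map. Qed.

Lemma all_fdom_e w : all (fdom e) w.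
Proof. by apply/allP => a _; exact: fdom_e. Qed.

(** The words that index the basis: the basis vectors exist and consecutive
    letters belong to different systems. *)
Definition admissible (l : seq letter) : bool :=
  all (fun x => x.2.2 < d x.1 (letter_deg x))%N l && Defs.alternating (map fst l).

Lemma admissible_cons x l : admissible (x :: l) =
  [&& (x.2.2 < d x.1 (letter_deg x))%N, ohead (colours l) != Some x.1
    & admissible l].
Proof.
rewrite /admissible alternating_cons /=.
by case: (_ < _)%N => //=; case: all => //=; rewrite andbF.
Qed.

(** The coefficients of the tensor product of the basis vectors that are
    listed in l, on the words of length [word_deg l]. *)
Fixpoint gen (l : seq letter) (w : seq A) : R[i] :=
  if l is x :: l' then
    coef (fr x.1) (beta x.1 (letter_deg x) x.2.2) (take (letter_deg x) w) *
    gen l' (drop (letter_deg x) w)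
  else (w == [::])%:R.

(** The generator of l is supported by the words with pattern [colours l]. *)
Lemma gen_off l w : size w = word_deg l -> map col w <> colours l ->
  gen l w = 0.
Proof.
elim: l w => [|x l IH] w /=; first by move=> /size0nil ->.
rewrite /word_deg /= -/(word_deg l) => wn wc.
have us : size (take (letter_deg x) w) = letter_deg x.
  by rewrite size_takel // wn leq_addr.
case: (boolP (all (fdom (fr x.1)) (take (letter_deg x) w))) => uD; last first.
  by rewrite coef_off ?mul0r.
rewrite IH ?mulr0 //; first by rewrite size_drop wn addKn.
move=> vc; apply: wc; rewrite -[w in LHS](cat_take_drop (letter_deg x)) map_cat.
by rewrite vc (map_col_fdom uD) us.
Qed.

(** The functions on words that are the coefficients of a tensor in the fibre
    of degree n of the free product. *)
Definition free_coef n (f : seq A -> R[i]) : Prop :=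
  forall u v, (size u + 2 + size v = n)%N ->
  forall b, H b 2%N (window (fr b) (TV b) f u v).

Lemma free_coef_ext n f g : (forall w, size w = n -> f w = g w) ->
  free_coef n f -> free_coef n g.
Proof.
move=> fg fP u v uv b; have := fP u v uv b; congr (H _ _).
by apply: of_coef_ext => w w2; rewrite fg // !size_cat w2 addnA.
Qed.

Lemma free_coefP n (z : T n) : M n z <-> free_coef n (coef e z).
Proof. exact: ME. Qed.

Lemma coef_of_coef n f w : size w = n -> coef e (of_coef e T n f) w = f w.
Proof. by move=> wn; rewrite of_coefK_dom // all_fdom_e. Qed.

Lemma free_coef_of_coef n f : M n (of_coef e T n f) <-> free_coef n f.
Proof.
rewrite free_coefP; split; apply: free_coef_ext => w wn.
  by rewrite coef_of_coef.
by rewrite coef_of_coef.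
Qed.

Lemma free_fibre_subspace n : is_subspace (M n).
Proof.
split=> [|a y z /ME My /ME Mz]; apply/ME => u v uv b.
  by rewrite /window of_coef0 => [|w _]; [case: (H2s b)|exact: dot0l].
rewrite /window (of_coef_ext _ _ (fun w _ => tensor_coef_lin e a y z _)).
rewrite of_coef_lin.
by have [_ Hl] := H2s b; apply: Hl; [exact: My|exact: Mz].
Qed.

(** A window of one colour only sees words with the same pattern, hence the
    restriction to a set of patterns preserves the fibre. *)
Lemma free_coef_pattern n (h : seq bool -> R[i]) f :
  free_coef n f -> free_coef n (fun w => h (map col w) * f w).
Proof.
move=> fP u v uv b.
have -> : window (fr b) (TV b) (fun w => h (map col w) * f w) u v =
    h (map col u ++ nseq 2 b ++ map col v) *: window (fr b) (TV b) f u v.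
  rewrite -of_coefZ; apply: of_coef_ext_dom => w w2 wD.
  by rewrite !map_cat (map_col_fdom wD) w2.
by apply: subspaceZ => //; exact: fP.
Qed.

Lemma fibre_windows b n (x : TV b n) : H b n x <->
  forall u v, (size u + 2 + size v = n)%N -> H b 2%N (window (fr b) (TV b) (coef (fr b) x) u v).
Proof. by rewrite HE; exact: max_fiberP. Qed.

Lemma gen_free_coef l : admissible l -> free_coef (word_deg l) (gen l).
Proof.
elim: l => [|x l IH]; first by move=> _ u v /eqP; rewrite addnAC addn2.
rewrite admissible_cons => /and3P[xd lx ladm] u v.
rewrite /word_deg /= -/(word_deg l) => uv b.
set n := letter_deg x in uv *; set y := beta x.1 n x.2.2.
have Hy : H x.1 n y by exact: beta_fibre.
(* the window lies in the tail of l *)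
case: (leqP n (size u)) => nu.
  have -> : window (fr b) (TV b) (gen (x :: l)) u v =
      coef (fr x.1) y (take n u) *: window (fr b) (TV b) (gen l) (drop n u) v.
    rewrite -of_coefZ; apply: of_coef_ext => w w2 /=.
    have dE : drop n (u ++ w ++ v) = drop n u ++ w ++ v.
      rewrite drop_cat ltn_neqAle nu andbT; case: eqP => [nu'|//].
      by rewrite nu' subnn drop0 drop_size.
    by rewrite -/n takel_cat // dE.
  apply: subspaceZ => //; apply: IH => //.
  by rewrite size_drop; apply/(@addnI n); rewrite -uv !addnA subnKC.
(* the window lies in the first factor *)
case: (ltnP (size u).+1 n) => nu2.
  pose k := (n - size u - 2)%N.
  have nE : (size u + 2 + k = n)%N by rewrite /k -subnDA subnKC // addn2.
  have -> : window (fr b) (TV b) (gen (x :: l)) u v =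
      of_coef (fr b) (TV b) 2 (fun w => gen l (drop k v) * coef (fr x.1) y (u ++ w ++ take k v)).
    apply: of_coef_ext => w w2 /=; rewrite -/n -/y mulrC.
    have uw : (n < size (u ++ w))%N = false.
      by rewrite size_cat w2 -nE ltnNge leq_addr.
    have nk : (n - size (u ++ w) = k)%N by rewrite size_cat w2 -nE addKn.
    have tE : take n (u ++ w ++ v) = u ++ w ++ take k v.
      by rewrite catA take_cat uw nk catA.
    have dE : drop n (u ++ w ++ v) = drop k v.
      by rewrite catA drop_cat uw nk.
    by rewrite tE dE.
  have [bx|bx] := eqVneq b x.1.
    subst b; rewrite of_coefZ; apply: subspaceZ => //.
    apply: (fibre_windows y).1 => //; rewrite size_takel //.
    by move: uv; rewrite -nE -!addnA !(addnA (size u)) => /addnI ->; rewrite leq_addr.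
  rewrite of_coef0_dom; first by case: (H2s b).
  move=> w w2 wD; rewrite coef_off ?mulr0 //.
    rewrite !size_cat w2 size_takel ?addnA //.
    by move: uv; rewrite -nE -!addnA => /addnI/addnI ->; rewrite leq_addr.
  rewrite !all_cat; apply: contra bx => /and3P[_ h _].
  case: w w2 wD h => // a w _ /= /andP[+ _] /andP[+ _].
  by rewrite !fdom_fr => /eqP <- /eqP <-.
(* the window meets two consecutive factors, which have different colours *)
have un : n = (size u).+1 by apply/eqP; rewrite eqn_leq nu nu2.
rewrite /window of_coef0_dom; first by case: (H2s b).
move=> [|a [|a' []]] // _ /= /andP[aD /andP[a'D _]]; rewrite -/n -/y.
have ua : size (rcons u a) = n by rewrite size_rcons un.
rewrite -cat_rcons take_size_cat // drop_size_cat //.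
have [bx|bx] := eqVneq b x.1; last first.
  rewrite coef_off ?mul0r //.
  rewrite all_rcons negb_and; apply/orP; left; apply: contra bx.
  by move: aD; rewrite !fdom_fr => /eqP <- /eqP <-.
rewrite [gen _ _]gen_off ?mulr0 //.
  by move: uv; rewrite un -addnA (addSnnS (size u)) => /eqP; rewrite eqn_add2l => /eqP[].
move=> /= lc; move: lx; rewrite -lc /= -bx.
by move: a'D; rewrite fdom_fr => /eqP ->; rewrite eqxx.
Qed.

(** The generators with a given pattern span the part of the fibre that is
    supported by this pattern. Spanning is expressed by quantification over
    all subspaces S that contain the generators. *)
Lemma gen_pattern_span n c f (S : set (T n)) : size c = n -> free_coef n f ->
  (forall w, size w = n -> map col w <> c -> f w = 0) ->
  is_subspace S ->
  (forall l, admissible l -> colours l = c -> S (of_coef e T n (gen l))) ->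
  S (of_coef e T n f).
Proof.
elim/ltn_ind: n c f S => n IH c f S cn fP fc Ss SG.
have [c0|/first_run[b [m [c' [cE cb]]]]] := eqVneq c [::].
  move: cn; rewrite c0 => n0; subst n.
  have -> : of_coef e T 0 f = f [::] *: of_coef e T 0 (gen [::]).
    rewrite -of_coefZ; apply: of_coef_ext => w /size0nil ->.
    by rewrite /= mulr1.
  by apply: subspaceZ => //; apply: SG => //; rewrite c0.
set n' := size c'.
have nE : n = (m.+1 + n')%N by rewrite -cn cE size_cat size_nseq.
clear cn; subst n; set k := m.+1 in IH fP fc S Ss SG *.
have foff v u : size v = n' -> size u = k -> ~~ all (fdom (fr b)) u -> f (u ++ v) = 0.
  move=> vn uk uD; apply: fc; first by rewrite size_cat uk vn.
  rewrite map_cat cE => /eqP; rewrite eqseq_cat ?size_map ?size_nseq //.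
  case/andP=> /eqP uE _; move: uD; rewrite all_fdom_fr uE.
  by rewrite (introT (all_pred1P _ _)) // size_nseq.
have fv v : size v = n' -> H b k (of_coef (fr b) (TV b) k (fun u => f (u ++ v))).
  move=> vn; apply/fibre_windows => u' v' uv.
  have -> : window (fr b) (TV b) (coef (fr b) (of_coef (fr b) (TV b) k
      (fun u => f (u ++ v)))) u' v' = window (fr b) (TV b) f u' (v' ++ v).
    apply: of_coef_ext => w w2; rewrite of_coefK ?catA //.
      by move=> u; exact: foff.
    by rewrite !size_cat w2.
  by apply: fP; rewrite size_cat vn addnA uv.
(* cf i is the coefficient on beta b k i of the slices of f along the first
   run, as a function of the rest of the word *)
pose cf i v := \sum_(u <- words A k) Num.conj (coef (fr b) (beta b k i) u) * f (u ++ v).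
have cfP i : free_coef n' (cf i).
  move=> u0 v0 uv b'; rewrite /window.
  rewrite (of_coef_ext _ _ (g := fun w => \sum_(u <- words A k)
    Num.conj (coef (fr b) (beta b k i) u) * f ((u ++ u0) ++ w ++ v0))); last first.
    by move=> w _; apply: eq_bigr => u _; rewrite -!catA.
  rewrite of_coef_sum big_seq; under eq_bigr => u _ do rewrite of_coefZ.
  apply: subspace_sum => // u; rewrite mem_words => /eqP uk.
  by apply: fP; rewrite size_cat uk -!addnA [(size u0 + _)%N]addnA uv.
have cfoff i w : size w = n' -> map col w <> c' -> cf i w = 0.
  move=> wn wc; rewrite /cf big_seq big1 // => u; rewrite mem_words => /eqP uk.
  rewrite fc ?mulr0 ?size_cat ?uk ?wn // map_cat cE => /eqP.
  rewrite eqseq_cat ?size_map ?size_nseq // => /andP[_ /eqP]; exact: wc.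
pose t i (g : seq A -> R[i]) (w : seq A) : R[i] :=
  coef (fr b) (beta b k i) (take k w) * g (drop k w).
have fE : of_coef e T (k + n') f = \sum_(i < d b k) of_coef e T (k + n') (t i (cf i)).
  rewrite -of_coef_sum; apply: of_coef_ext => w wn.
  have uk : size (take k w) = k by rewrite size_takel // wn leq_addr.
  have vn : size (drop k w) = n' by rewrite size_drop wn addKn.
  rewrite /t -{1}(cat_take_drop k w).
  move: (take k w) (drop k w) uk vn => u v uk vn.
  rewrite -(of_coefK (TV b) (fun g => @foff v g vn) uk).
  rewrite [in LHS](beta_expand (fv v vn)) tensor_coef_sum; apply: eq_bigr => i _.
  rewrite tensor_coefZ mulrC; congr (_ * _).
  rewrite (dot_coef (fr b)); apply: eq_big_seq => g; rewrite mem_words => /eqP gk.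
  by rewrite of_coefK // 1?mulrC // => h; exact: foff.
(* the induction hypothesis is applied to the subspace of the tensors whose
   concatenation with beta b k i belongs to S *)
rewrite fE; under eq_bigr => i _ do rewrite -[of_coef _ _ _ _]scale1r.
apply: subspace_sum => // i _.
pose S' : set (T n') := [set y | S (of_coef e T (k + n') (t i (coef e y)))].
have text g g' : (forall w, size w = n' -> g w = g' w) ->
    of_coef e T (k + n') (t i g) = of_coef e T (k + n') (t i g').
  move=> gg; apply: of_coef_ext => w wn; rewrite /t gg //.
  by rewrite size_drop wn addKn.
have : S' (of_coef e T n' (cf i)).
  apply: (IH n' _ c') => //; first by rewrite -[X in (X < _)%N]add0n ltn_add2r.
  - exact: cfoff.
  - split=> [|a y z]; rewrite /S' /=.
      rewrite of_coef0; first by case: Ss.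
      by move=> w _; rewrite /t /coef dot0l mulr0.
    have -> : of_coef e T (k + n') (t i (coef e (a *: y + z))) =
        a *: of_coef e T (k + n') (t i (coef e y)) + of_coef e T (k + n') (t i (coef e z)).
      rewrite -of_coef_lin; apply: of_coef_ext => w _.
      by rewrite /t tensor_coef_lin mulrDr mulrCA.
    by move=> yS zS; case: Ss => _; apply.
  move=> l ladm lc; rewrite /S' /=.
  rewrite (text _ (gen l)); last by move=> w wn; rewrite coef_of_coef.
  apply: (SG ((b, (m, nat_of_ord i)) :: l)); last by rewrite cE -lc.
  by rewrite admissible_cons /= ltn_ord lc cb.
by rewrite /S' /= (text _ (cf i)) // => w wn; rewrite coef_of_coef.
Qed.

(** The fibres of the free product are spanned by the generators. *)
Lemma gen_span n (z : T n) (S : set (T n)) : M n z -> is_subspace S ->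
  (forall l, admissible l -> word_deg l = n -> S (of_coef e T n (gen l))) ->
  S z.
Proof.
move=> /free_coefP zP Ss SG; rewrite -(tensor_coefK e z).
pose f c w : R[i] := (map col w == c)%:R * coef e z w.
have -> : of_coef e T n (coef e z) = \sum_(c <- words bool n) of_coef e T n (f c).
  rewrite -of_coef_sum; apply: of_coef_ext => w wn.
  have wc : map col w \in words bool n by rewrite mem_words size_map wn.
  rewrite (bigD1_seq (map col w)) ?words_uniq //= {1}/f eqxx mul1r.
  by rewrite big1 ?addr0 // => c cw; rewrite /f eq_sym (negPf cw) mul0r.
rewrite big_seq; under eq_bigr => c _ do rewrite -[of_coef _ _ _ _]scale1r.
apply: subspace_sum => // c; rewrite mem_words => /eqP cn.
apply: (gen_pattern_span cn) => //.
- exact: (free_coef_pattern (fun c' => (c' == c)%:R) zP).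
- by move=> w wn /eqP/negPf wc; rewrite /f wc mul0r.
by move=> l ladm lc; apply: SG => //; rewrite -size_colours lc.
Qed.

(** The generators are orthonormal. *)
Lemma gen_gram n l l' : admissible l -> admissible l' ->
  word_deg l = n -> word_deg l' = n ->
  '[of_coef e T n (gen l), of_coef e T n (gen l')] = (l == l')%:R.
Proof.
move=> la la' ln ln'; rewrite (dot_coef e).
transitivity (\sum_(w <- words A n) gen l w * Num.conj (gen l' w)).
  by apply: eq_big_seq => w; rewrite mem_words => /eqP wn; rewrite !coef_of_coef.
elim: l l' n la la' ln ln' => [|x l IH] l' n la la' ln ln'.
  move: ln ln'; rewrite {1}/word_deg /= => <-; case: l' la' => [|//] _ _.
  by rewrite big_seq1 /= conjC1 mulr1.
have [cc|cc] := eqVneq (colours (x :: l)) (colours l'); last first.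
  rewrite (_ : _ == l' = false); last by apply: contraNF cc => /eqP ->.
  rewrite big_seq big1 // => w; rewrite mem_words => /eqP wn.
  have [wc|wc] := eqVneq (map col w) (colours (x :: l)).
    rewrite [gen l' w]gen_off ?conjC0 ?mulr0 ?wn ?ln' //.
    by rewrite wc => /eqP; exact: negP.
  by rewrite gen_off ?mul0r ?wn ?ln //; exact/eqP.
case: l' la' ln' cc => [|x' l'] la' ln' cc; first by case: x cc {la ln} => b [].
move: la la' ln ln' cc; rewrite !admissible_cons.
case: x => b [m i]; case: x' => b' [m' i'] /= /and3P[id lb la] /and3P[id' lb' la'].
rewrite /word_deg /= /letter_deg /= -!/(word_deg _) => ln ln' cc.
have bb : b = b' by case: cc.
(* equal patterns have equal first runs *)
subst b'; have [[mm] lc] := nseq_cat_inj lb lb' (cc : nseq m.+1 b ++ colours l = nseq m'.+1 b ++ colours l').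
subst m'; subst n; move/addnI: ln' => ln'.
rewrite sum_words_cat eqseq_cons !xpair_eqE !eqxx /=.
transitivity ('[beta b m.+1 i, beta b m.+1 i'] * (l == l')%:R).
  rewrite -(IH l' _ la la' (erefl _) ln') (dot_coef (fr b)) big_distrlr /=.
  apply: eq_big_seq => u; rewrite mem_words => /eqP us.
  apply: eq_bigr => v _.
  by rewrite take_size_cat // drop_size_cat // rmorphM /= mulrACA.
by rewrite beta_gram // -natrM mulnb.
Qed.

End FreeFibres.


(** * Totality in sums and tensor products *)

Section Totality.
Context {R : realType}.

Lemma closed_span_min (E : hilbert R) (A B : set E) :
  A `<=` closed_span B -> closed_span A `<=` closed_span B.
Proof.
move=> AB x Ax; apply: (@closed_span_image _ E E setT id 1 A B) => //.
by move=> y _; rewrite mul1r.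
Qed.

(** The embedding of a summand preserves closed spans. *)
Lemma hsum_inj_closed_span (I : Type) (E : I -> hilbert R)
    (S : forall i, set (E i)) (F : hilbert_sum E S) i (C : set (E i)) (B : set F) :
  is_subspace (S i) -> C `<=` S i ->
  (forall x, C x -> closed_span B (hsum_inj F x)) ->
  forall x, S i x -> closed_span C x -> closed_span B (hsum_inj F x).
Proof.
move=> Ss CS CB; apply: (@closed_span_image _ _ _ (S i) _ 1) => //.
  by move=> a x y Sx Sy; exact: hsum_linear.
by move=> x Sx; rewrite mul1r (eq_norm (hsum_isometry F Sx Sx)).
Qed.

Lemma hsum_total_of (I : Type) (E : I -> hilbert R)
    (S : forall i, set (E i)) (F : hilbert_sum E S) (B : set F) :
  (forall i (x : E i), S i x -> closed_span B (hsum_inj F x)) -> Defs.total B.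
Proof.
move=> SB; apply/seteqP; split=> // z _.
have : closed_span [set z | exists i (x : E i), S i x /\ z = hsum_inj F x] z.
  by rewrite /closed_span (hsum_total F).
by apply: closed_span_min => _ [i [x [Sx ->]]]; exact: SB.
Qed.

Section Tensor.
Context (p : nat) (E : 'I_p -> hilbert R) (S : forall k, set (E k))
  (X : hilbert_tensor E S).
Arguments S : clear implicits.

Lemma tens_norm (x : forall k, E k) : (forall k, S k (x k)) ->
  `|tens X x| = \prod_(k < p) `|x k|.
Proof.
move=> Sx; apply/eqP; rewrite -(@eqrXn2 _ 2) ?prodr_ge0 //.
by rewrite hilbert_normE tens_dot // -prodrXl; apply/eqP/eq_bigr => k _;
  rewrite hilbert_normE.
Qed.

(** If every S k is the closed span of D k, the elementary tensors of
    elements of the D k are total: one replaces one factor after the other. *)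
Lemma tens_total_of (D : forall k, set (E k)) :
  (forall k, is_subspace (S k)) -> (forall k, D k `<=` S k) ->
  (forall k x, S k x -> closed_span (D k) x) ->
  Defs.total [set z | exists x : forall k, E k,
    (forall k, D k (x k)) /\ z = tens X x].
Proof.
move=> Ss DS SD; set B := [set z | _].
(* the factors from the j-th one on are in the D k, the others arbitrary *)
suff main j (x : forall k, E k) : (j <= p)%N -> (forall k, S k (x k)) ->
    (forall k : 'I_p, (j <= k)%N -> D k (x k)) -> closed_span B (tens X x).
  apply/seteqP; split=> // z _.
  have : closed_span [set z | exists x : forall k, E k,
      (forall k, S k (x k)) /\ z = tens X x] z.
    by rewrite /closed_span (tens_total X).
  apply: closed_span_min => _ [x [Sx ->]].
  by apply: (main p) => // k; rewrite leqNgt ltn_ord.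
elim: j x => [|j IH] x jp Sx Dx.
  by apply: sub_closed_span; exists x; split=> // k; exact: Dx.
pose k0 := Ordinal jp.
have Sd y : S k0 y -> forall k, S k (eqtype.dfwith x y k).
  by move=> Sy k; case: eqtype.dfwithP.
have -> : x = eqtype.dfwith x (x k0).
  by apply: functional_extensionality_dep => k; case: eqtype.dfwithP.
pose c := \prod_(k < p | k != k0) `|x k|.
apply: (@closed_span_image _ (E k0) X (S k0) (fun y => tens X (eqtype.dfwith x y))
  c (D k0) B) => //; last exact: SD.
- by rewrite /c prodr_ge0.
- move=> a y z Sy Sz; apply: (tens_multilinear X (k := k0)).
  + exact: Sd.
  + exact: Sd.
  + by move=> l lk; rewrite !dfwith_out // eq_sym.
  + by rewrite !dfwith_in.
- move=> y Sy; rewrite tens_norm; last exact: Sd.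
  rewrite (bigD1 k0) //= dfwith_in mulrC /c.
  rewrite (eq_bigr (fun k => `|x k|)) // => k kk0.
  by rewrite dfwith_out // eq_sym.
- move=> y Dy; apply: IH; [exact: ltnW|by apply: Sd; exact: DS|].
  move=> k; case: (eqtype.dfwithP x y k) => // k' kk' jk.
  by apply: Dx; rewrite ltn_neqAle jk andbT; exact: kk'.
Qed.

End Tensor.

End Totality.

(** * A basis of the free product of Hilbert spaces *)

(* eps b is an orthonormal basis of the complement of the distinguished
   vector of E b, indexed by the pairs that satisfy basis_index b. *)
Section FreeProductBasis.
Context {R : realType} (E : bool -> pointed_hilbert R) (P : hilbert_free_product E)
  (d : bool -> nat -> nat) (eps : forall b, nat * nat -> E b).

(** The pair (m, i) denotes the basis vector number i of degree m + 1. *)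
Definition basis_index b (j : nat * nat) : bool := (j.2 < d b j.1.+1)%N.

Hypothesis eps_ortho : forall b j, basis_index b j ->
  orthocompl [set ph_vec (E b)] (eps b j).
Hypothesis eps_gram : forall b i j, basis_index b i -> basis_index b j ->
  '[eps b i, eps b j] = (i == j)%:R.
Hypothesis eps_total : forall b x, orthocompl [set ph_vec (E b)] x ->
  closed_span [set z | exists2 j, basis_index b j & z = eps b j] x.

(** The elementary tensor of the basis vectors listed in q, for the word s. *)
Definition eps_tens (s : seq bool) (q : seq (nat * nat)) : hfp_tensor P s :=
  tens (hfp_tensor P s)
    (fun k : 'I_(size s) => eps (nth true s k) (nth (0, 0)%N q k)).

(** The same tensor in the free product. *)
Definition hfp_gen (s : {s : seq bool | Defs.alternating s})
    (q : seq (nat * nat)) : P := hsum_inj (hfp_space P) (eps_tens (sval s) q).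

(** The basis vector of the free product that is indexed by l. *)
Definition free_basis (l : {l : seq letter | admissible d l}) : P :=
  hfp_gen (exist _ (map fst (sval l)) (andP (svalP l)).2) (map snd (sval l)).

Lemma admissible_index l k : admissible d l -> (k < size l)%N ->
  basis_index (nth true (map fst l) k) (nth (0, 0)%N (map snd l) k).
Proof.
move=> /andP[/allP la _] kl.
rewrite !(nth_map (true, (0, 0)%N)) //.
exact/(la (nth (true, (0, 0)%N) l k))/mem_nth.
Qed.

Lemma hfp_gen_gram s s' q q' :
  size q = size (sval s) -> size q' = size (sval s') ->
  (forall k, (k < size (sval s))%N ->
    basis_index (nth true (sval s) k) (nth (0, 0)%N q k)) ->
  (forall k, (k < size (sval s'))%N ->
    basis_index (nth true (sval s') k) (nth (0, 0)%N q' k)) ->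
  '[hfp_gen s q, hfp_gen s' q'] = ((s == s') && (q == q'))%:R.
Proof.
move=> sq sq' iP iP'; have [ss|ss] := eqVneq s s'; last first.
  by apply: hsum_ortho => //; exact/eqP.
subst s'; rewrite (hsum_isometry (hfp_space P)) //.
rewrite tens_dot => [|k|k]; [|exact/eps_ortho/iP|exact/eps_ortho/iP'].
rewrite (eq_bigr (fun k : 'I_(size (sval s)) =>
  (nth (0, 0)%N q k == nth (0, 0)%N q' k)%:R)); last first.
  by move=> k _; rewrite eps_gram //; [exact: iP|exact: iP'].
have [->|qq] := eqVneq q q'; first by rewrite big1 // => k _; rewrite eqxx.
have [k qk] : exists k : 'I_(size (sval s)), nth (0, 0)%N q k != nth (0, 0)%N q' k.
  apply: contrapT => nk; move/eqP: qq; apply.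
  apply: (@eq_from_nth _ (0, 0)%N); rewrite sq ?sq' // => k ks.
  by apply/eqP/negPn/negP => h; apply: nk; exists (Ordinal ks).
by rewrite (bigD1 k) //= (negPf qk) mul0r.
Qed.

Lemma free_basis_gram l l' : '[free_basis l, free_basis l'] = (l == l')%:R.
Proof.
case: l l' => [l la] [l' la']; rewrite /free_basis hfp_gen_gram /= ?size_map //;
  try by move=> k kl; exact: admissible_index.
rewrite -!val_eqE /=; congr (_ : bool)%:R; apply/andP/eqP => [[/eqP ss /eqP qq]|->//].
by rewrite -(zip_unzip l) -(zip_unzip l') /unzip1 /unzip2 ss qq.
Qed.

Lemma free_basis_total : Defs.total (range free_basis).
Proof.
apply: hsum_total_of => -[s alt] x _ /=.
pose D (k : 'I_(size s)) : set (E (nth true s k)) :=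
  [set z | exists2 j, basis_index (nth true s k) j & z = eps (nth true s k) j].
have totD := @tens_total_of R (size s) (fun k : 'I_(size s) => E (nth true s k))
  _ (hfp_tensor P s) D.
apply: (@hsum_inj_closed_span _ _ _ _ (hfp_space P) (exist _ s alt)
  [set z | exists x : forall k : 'I_(size s), E (nth true s k),
    (forall k, D k (x k)) /\ z = tens (hfp_tensor P s) x]) => //; last first.
  rewrite /closed_span totD //.
  - by move=> k; exact: orthocompl_subspace.
  - by move=> k _ [j ij ->]; exact: eps_ortho.
  - by move=> k y; exact: eps_total.
move=> _ [y [Dy ->]]; apply: sub_closed_span.
have /choice[g gP] (k : 'I_(size s)) : exists j, basis_index (nth true s k) j /\
    y k = eps (nth true s k) j by have [j ij ->] := Dy k; exists j.
pose q := [seq g k | k <- enum 'I_(size s)].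
have sq : size s = size q by rewrite size_map size_enum_ord.
have qE (k : 'I_(size s)) : nth (0, 0)%N q k = g k.
  by rewrite (nth_map k) ?size_enum_ord // nth_ord_enum.
have e1 : map fst (zip s q) = s by apply: unzip1_zip; rewrite sq.
have e2 : map snd (zip s q) = q by apply: unzip2_zip; rewrite sq.
have la : admissible d (zip s q).
  rewrite /admissible e1 alt andbT; apply/(all_nthP (true, (0, 0)%N)) => k.
  rewrite size_zip -sq minnn => ks; rewrite nth_zip //=.
  by have := (gP (Ordinal ks)).1; rewrite -qE.
exists (exist (fun l => is_true (admissible d l)) _ la) => //; rewrite /free_basis /= e2.
have genE s1 s2 : s1 = s2 -> hfp_gen s1 q = hfp_gen s2 q by move=> ->.
rewrite (genE _ (exist (fun s => is_true (Defs.alternating s)) s alt)); last first.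
  exact: val_inj.
rewrite /hfp_gen /=; congr (hsum_inj _ _); congr (tens _ _).
apply: functional_extensionality_dep => k.
by rewrite qE (gP k).2.
Qed.

End FreeProductBasis.

(** * Bases of the Fock spaces *)

Section FockBasis.
Context {R : realType} (V : hilbert R) (A : finType) (e : frame V A)
  (T : tensor_powers V) (H : forall n, set (T n)) (quadH : quadratic H)
  (F : fock H) (d : nat -> nat) (beta : forall n, nat -> T n).
Arguments H : clear implicits.
Hypothesis beta_fibre : forall n i, (i < d n)%N -> H n (beta n i).
Hypothesis beta_gram : forall n i j, (i < d n)%N -> (j < d n)%N ->
  '[beta n i, beta n j] = (i == j)%:R.
Hypothesis beta_expand : forall n x, H n x ->
  x = \sum_(i < d n) '[x, beta n i] *: beta n i.

(** The basis vectors of positive degree of the Fock space. *)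
Definition fock_basis (j : nat * nat) : pointed_fock quadH F :=
  hsum_inj F (beta j.1.+1 j.2).

Lemma fock_fibre_subspace n : is_subspace (H n).
Proof. by have [[]] := quadH. Qed.

Lemma fock_vacuum_fibre (y : T 0) : H 0%N y.
Proof. by have [[_ -> _ _] _] := quadH. Qed.

Lemma fock_basis_ortho j : (j.2 < d j.1.+1)%N ->
  orthocompl [set ph_vec (pointed_fock quadH F)] (fock_basis j).
Proof.
move=> jd _ ->; apply: hsum_ortho => //; first exact: beta_fibre.
exact: fock_vacuum_fibre.
Qed.

Lemma fock_basis_gram i j : (i.2 < d i.1.+1)%N -> (j.2 < d j.1.+1)%N ->
  '[fock_basis i, fock_basis j] = (i == j)%:R.
Proof.
case: i j => [m i] [n j] /= id jd; rewrite /fock_basis xpair_eqE /=.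
have [mn|mn] := eqVneq m n; last first.
  by apply: hsum_ortho; [move=> [/eqP]; apply/negP|exact: beta_fibre|exact: beta_fibre].
by subst n; rewrite (hsum_isometry F) ?beta_gram //; exact: beta_fibre.
Qed.

Lemma fock_basis_total x : orthocompl [set ph_vec (pointed_fock quadH F)] x ->
  closed_span [set z | exists2 j, (j.2 < d j.1.+1)%N & z = fock_basis j] x.
Proof.
set vac := ph_vec _; set B := [set z | _] => xv.
have vv : '[vac, vac] = 1 by exact: ph_unit.
have Bv y : linear_span B y -> '[vac, y] = 0.
  move: y; apply: (@linear_span_min _ _ B [set y | '[vac, y] = 0]) => [|_ [j jd ->]] /=.
    split=> [|a y z /= y0 z0]; first exact: dot0r.
    by rewrite dotDZr y0 z0 mulr0 addr0.
  by rewrite dotC fock_basis_ortho ?conjC0.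
pose S : set (pointed_fock quadH F) :=
  [set z | exists (a : R[i]) y, linear_span B y /\ z = a *: vac + y].
have [B0 Bl] := linear_span_subspace B.
have Ss : is_subspace S.
  split=> [|a _ _ [b [y [By ->]]] [c [z [Bz ->]]]].
    by exists 0, 0; split=> //; rewrite scale0r addr0.
  exists (a * b + c), (a *: y + z); split; first exact: Bl.
  by rewrite scalerDr scalerA scalerDl addrACA.
have FS : linear_span [set z | exists n (y : T n), H n y /\ z = hsum_inj F y] `<=` S.
  apply: linear_span_min => // _ [[|n] [y [Hy ->]]].
    exists (coef e y [::]), 0; split=> //; rewrite addr0.
    rewrite /vac /= {1}(coef_expand e y) big_seq1.
    have -> : pword e T 0 [::] = pure T 0 (fun _ => 0) by exact: pure_eq.
    have := hsum_linear F (coef e y [::]) (fock_vacuum_fibre (pure T 0 (fun=> 0)))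
      (fock_vacuum_fibre 0).
    have -> : hsum_inj F (0 : T 0) = 0.
      by apply/eqP; rewrite -(dnorm_eq0 (hilbert_dot F)) (hsum_isometry F) ?dot0l //;
        exact: fock_vacuum_fibre.
    by rewrite !addr0.
  exists 0, (hsum_inj F y); rewrite scale0r add0r; split=> //.
  pose S' : set (T n.+1) := [set u | H n.+1 u /\ linear_span B (hsum_inj F u)].
  suff : S' y by case.
  have [H0 Hl] := fock_fibre_subspace n.+1.
  rewrite (beta_expand Hy); apply: subspace_sum => [|i _].
    split=> [|a u v [Hu Bu] [Hv Bv']]; split=> //.
    - have -> : hsum_inj F (0 : T n.+1) = 0; last by [].
      by apply/eqP; rewrite -(dnorm_eq0 (hilbert_dot F)) (hsum_isometry F) ?dot0l.
    - exact: Hl.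
    - by rewrite (hsum_linear F) //; exact: Bl.
  split; first exact: beta_fibre.
  by apply: sub_linear_span; exists (n, nat_of_ord i) => //=.
have /closureP xS : closure (linear_span
  [set z | exists n (y : T n), H n y /\ z = hsum_inj F y]) x.
  by rewrite (hsum_total F).
apply/closureP => eta eta0; have [_ /FS[a [y [By ->]]] xy] := xS _ eta0.
exists y => //; apply: le_lt_trans xy.
(* x - y is orthogonal to the vacuum, hence the projection of x - z *)
rewrite -(@ler_pXn2r _ 2) ?nnegrE // !hilbert_normE.
have -> : x - (a *: vac + y) = (x - y) - a *: vac.
  by rewrite opprD addrA addrAC.
have vxy : '[x - y, a *: vac] = 0.
  by rewrite dotZr dotBl xv // (dotC y) Bv // conjC0 subrr mulr0.
rewrite (hnormBd vxy) lerDl.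
exact: dnorm_ge0.
Qed.

End FockBasis.

Section FreeFockBasis.
Context {R : realType} (W : hilbert R) (A : finType) (e : frame W A)
  (T : tensor_powers W) (V : bool -> hilbert R)
  (TV : forall b, tensor_powers (V b)) (fr : forall b, frame (V b) A)
  (col : A -> bool) (H : forall b n, set (TV b n)) (M : forall n, set (T n)).
Arguments H : clear implicits.
Arguments M : clear implicits.
Hypothesis fdom_e : forall a, fdom e a.
Hypothesis fdom_fr : forall b a, fdom (fr b) a = (col a == b).
Hypothesis H2s : forall b, is_subspace (H b 2%N).
Hypothesis HE : forall b n, H b n = max_fiber (H b 2%N) n.
Hypothesis ME : forall n z, M n z <->
  forall u v, (size u + 2 + size v = n)%N ->
  forall b, H b 2%N (window (fr b) (TV b) (coef e z) u v).

Context (d : bool -> nat -> nat) (beta : forall b n, nat -> TV b n).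
Hypothesis beta_fibre : forall b n i, (i < d b n)%N -> H b n (beta b n i).
Hypothesis beta_gram : forall b n i j, (i < d b n)%N -> (j < d b n)%N ->
  '[beta b n i, beta b n j] = (i == j)%:R.
Hypothesis beta_expand : forall b n x, H b n x ->
  x = \sum_(i < d b n) '[x, beta b n i] *: beta b n i.
Context (F : fock M).

(** The basis vector of the Fock space of the free product system that is
    indexed by l. *)
Definition free_fock_basis (l : {l : seq letter | admissible d l}) : F :=
  hsum_inj F (of_coef e T (word_deg (sval l)) (gen fr beta (sval l))).

Lemma gen_fibre l : admissible d l ->
  M (word_deg l) (of_coef e T (word_deg l) (gen fr beta l)).
Proof.
by move=> la; apply/(free_coef_of_coef fdom_e ME)/(gen_free_coef fdom_fr H2s HE beta_fibre la).
Qed.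

Lemma free_fock_basis_gram l l' :
  '[free_fock_basis l, free_fock_basis l'] = (l == l')%:R.
Proof.
rewrite -val_eqE /=; case: l l' => [l la] [l' la']; rewrite /free_fock_basis /=.
have [ll|ll] := eqVneq (word_deg l) (word_deg l'); last first.
  rewrite (_ : _ == _ = false); last by apply: contraNF ll => /eqP ->.
  by apply: hsum_ortho; [exact/eqP|exact: gen_fibre|exact: gen_fibre].
have := gen_fibre la'; rewrite -ll => Ml'.
rewrite (hsum_isometry F) //; last exact: gen_fibre.
by apply: (gen_gram T fdom_e fdom_fr beta_gram).
Qed.

Lemma free_fock_basis_total : Defs.total (range free_fock_basis).
Proof.
apply: hsum_total_of => n z Mz.
pose S : set (T n) := [set y | M n y /\ closed_span (range free_fock_basis) (hsum_inj F y)].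
suff : S z by case.
have [M0 Ml] := free_fibre_subspace H2s ME n.
have [B0 Bl] := closed_span_subspace (range free_fock_basis).
apply: (gen_span fdom_e fdom_fr H2s HE ME beta_expand Mz) => [|l la ln].
  split=> [|a u v [Mu Bu] [Mv Bv]]; split=> //.
  - have -> : hsum_inj F (0 : T n) = 0; last by [].
    by apply/eqP; rewrite -(dnorm_eq0 (hilbert_dot F)) (hsum_isometry F) ?dot0l.
  - exact: Ml.
  - by rewrite (hsum_linear F) //; exact: Bl.
subst n; split; first exact: gen_fibre.
by apply: sub_closed_span; exists (exist (fun l => is_true (admissible d l)) l la).
Qed.

End FreeFockBasis.


(** * Bases of the spaces of degree one *)

Section SumFrames.
Context {R : realType}.

Lemma finite_dim_onb (V : hilbert R) : finite_dim V ->
  exists (n : nat) (u : 'I_n -> V), (forall i j, '[u i, u j] = (i == j)%:R) /\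
    (forall x, x = \sum_i '[x, u i] *: u i).
Proof.
move=> [N [v vT]]; have [||d [u [_ gu eu]]] := @ex_onb R V N v setT.
- by split.
- by rewrite vT.
exists d, u; split=> [i j|x]; last exact: eu.
by rewrite gu // val_eqE.
Qed.

Lemma onb_parseval (V : hilbert R) n (u : 'I_n -> V) x :
  (forall x, x = \sum_i '[x, u i] *: u i) ->
  '[x, x] = \sum_i '[x, u i] * Num.conj '[x, u i].
Proof.
move=> eu; rewrite {1}(eu x) dot_suml; apply: eq_bigr => i _.
by rewrite dotZl -dotC.
Qed.

Context (V W : hilbert R) (m n : nat) (u : 'I_m -> V) (w : 'I_n -> W).
Hypothesis u_gram : forall i j, '[u i, u j] = (i == j)%:R.
Hypothesis w_gram : forall i j, '[w i, w j] = (i == j)%:R.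
Hypothesis u_expand : forall x, x = \sum_i '[x, u i] *: u i.
Hypothesis w_expand : forall x, x = \sum_i '[x, w i] *: w i.

(** The alphabet is the disjoint union of the index sets of the two bases; the
    left letters have colour [true]. In the frame of one summand the letters of
    the other colour are sent to 0. *)
Definition sum_colour (a : 'I_m + 'I_n) : bool := if a is inl _ then true else false.

(** The basis u, as a family indexed by all letters. *)
Definition left_vec (a : 'I_m + 'I_n) : V :=
  if a is inl i then u i else 0.

Lemma left_gram a b :
  '[left_vec a, left_vec b] = ((a == b) && (sum_colour a == true))%:R.
Proof.
case: a b => [i|i] [j|j] /=; rewrite ?dot0l ?dot0r ?andbF //.
by rewrite u_gram andbT.
Qed.

Lemma left_parseval x :
  '[x, x] = \sum_a '[x, left_vec a] * Num.conj '[x, left_vec a].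
Proof.
rewrite big_sumType /= [X in _ + X]big1 ?addr0; first exact: onb_parseval.
by move=> i _; rewrite dot0r mul0r.
Qed.

Definition frame_left : frame V ('I_m + 'I_n)%type :=
  Frame left_gram left_parseval.

(** The basis w, as a family indexed by all letters. *)
Definition right_vec (a : 'I_m + 'I_n) : W :=
  if a is inr i then w i else 0.

Lemma right_gram a b :
  '[right_vec a, right_vec b] = ((a == b) && (sum_colour a == false))%:R.
Proof.
case: a b => [i|i] [j|j] /=; rewrite ?dot0l ?dot0r ?andbF //.
by rewrite w_gram andbT.
Qed.

Lemma right_parseval x :
  '[x, x] = \sum_a '[x, right_vec a] * Num.conj '[x, right_vec a].
Proof.
rewrite big_sumType /= [X in X + _]big1 ?add0r; first exact: onb_parseval.
by move=> i _; rewrite dot0r mul0r.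
Qed.

Definition frame_right : frame W ('I_m + 'I_n)%type :=
  Frame right_gram right_parseval.

Context (VW : oplus V W).

(** The union of the two bases. *)
Definition frame_sum_vec (a : 'I_m + 'I_n) : VW :=
  match a with inl i => oplus_inl VW (u i) | inr j => oplus_inr VW (w j) end.

Lemma oplus_inl_dot x y : '[oplus_inl VW x, oplus_inl VW y] = '[x, y].
Proof. exact: (@hsum_isometry _ _ _ _ VW true). Qed.

Lemma oplus_inr_dot x y : '[oplus_inr VW x, oplus_inr VW y] = '[x, y].
Proof. exact: (@hsum_isometry _ _ _ _ VW false). Qed.

Lemma oplus_inl_inr x y : '[oplus_inl VW x, oplus_inr VW y] = 0.
Proof. exact: (@hsum_ortho _ _ _ _ VW true false). Qed.

Lemma oplus_inr_inl x y : '[oplus_inr VW x, oplus_inl VW y] = 0.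
Proof. exact: (@hsum_ortho _ _ _ _ VW false true). Qed.

Lemma frame_sum_inl a x :
  '[frame_sum_vec a, oplus_inl VW x] = '[frame_left a, x].
Proof.
by case: a => i /=; rewrite ?oplus_inl_dot // oplus_inr_inl dot0l.
Qed.

Lemma frame_sum_inr a x :
  '[frame_sum_vec a, oplus_inr VW x] = '[frame_right a, x].
Proof.
by case: a => i /=; rewrite ?oplus_inr_dot // oplus_inl_inr dot0l.
Qed.

Lemma dot_frame_sum_inl a x :
  '[oplus_inl VW x, frame_sum_vec a] = '[x, frame_left a].
Proof. by rewrite dotC frame_sum_inl -dotC. Qed.

Lemma dot_frame_sum_inr a x :
  '[oplus_inr VW x, frame_sum_vec a] = '[x, frame_right a].
Proof. by rewrite dotC frame_sum_inr -dotC. Qed.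

Lemma frame_sum_gram a b : '[frame_sum_vec a, frame_sum_vec b] = (a == b)%:R.
Proof.
case: b => j /=; rewrite ?frame_sum_inl ?frame_sum_inr; case: a => i /=;
  by rewrite ?dot0l ?u_gram ?w_gram.
Qed.

Lemma frame_sum_parseval x :
  '[x, x] = \sum_a '[x, frame_sum_vec a] * Num.conj '[x, frame_sum_vec a].
Proof.
have ex : x = \sum_a '[x, frame_sum_vec a] *: frame_sum_vec a.
  move: x; apply: (@parseval_expansion R VW _ _ xpredT frame_sum_vec _ _ _
    (hsum_total VW)).
  - exact: index_enum_uniq.
  - by move=> a b _ _; rewrite frame_sum_gram andbT.
  move=> _ [[] [x [_ ->]]].
  - rewrite (hsum_isometry VW) // (frame_parseval frame_left).
    apply: eq_bigr => a _.
    by rewrite -/(oplus_inl VW x) dot_frame_sum_inl.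
  - rewrite (hsum_isometry VW) // (frame_parseval frame_right).
    apply: eq_bigr => a _.
    by rewrite -/(oplus_inr VW x) dot_frame_sum_inr.
rewrite {1}ex dot_suml; apply: eq_bigr => a _.
by rewrite dotZl -dotC.
Qed.

Lemma frame_sum_gram_dom a b :
  '[frame_sum_vec a, frame_sum_vec b] = ((a == b) && true)%:R.
Proof. by rewrite frame_sum_gram andbT. Qed.

Definition frame_sum : frame VW ('I_m + 'I_n)%type :=
  @Frame R VW _ frame_sum_vec xpredT frame_sum_gram_dom frame_sum_parseval.

End SumFrames.

(** * Fibres of quadratic systems *)

Lemma quadratic_fibres (R : realType) (V : hilbert R) (T : tensor_powers V)
    (H : forall n, set (T n)) : quadratic H ->
  (exists Rel, H 2%N = orthocompl Rel) /\
  forall n, H n = max_fiber (H 2%N) n.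
Proof.
move=> [_ [Rel [_ HR]]]; have H2 := HR 2%N; rewrite max_fiber2 in H2.
by split=> [|n]; [exists Rel|rewrite H2].
Qed.

(** The degree two fibre of the free product, in terms of the restrictions
    of a tensor to the words of one colour. *)
Lemma free_fiber2P (R : realType) (V W : hilbert R) (A : finType)
    (VW : oplus V W) (frV : frame V A) (frW : frame W A) (e : frame VW A)
    (TV : tensor_powers V) (TW : tensor_powers W) (T : tensor_powers VW)
    (H : forall n, set (TV n)) (K : forall n, set (TW n)) (z : T 2) :
  (forall a x, '[e a, oplus_inl VW x] = '[frV a, x]) ->
  (forall a x, '[e a, oplus_inr VW x] = '[frW a, x]) ->
  (exists Rel, H 2%N = orthocompl Rel) ->
  (exists Rel, K 2%N = orthocompl Rel) ->
  free_fiber2 T H K z <->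
  H 2%N (of_coef frV TV 2 (coef e z)) /\ K 2%N (of_coef frW TW 2 (coef e z)).
Proof.
move=> el er [RH HE] [RK KE].
rewrite HE KE -(tensor_image2_ortho RH z el) -(tensor_image2_ortho RK z er).
rewrite -HE -KE.
have im0 (V' W' : hilbert R) (T1 : tensor_powers V') (T2 : tensor_powers W')
    (f : V' -> W') (S : set (T1 2)) : @tensor_image2 R V' W' T1 T2 f (orthocompl S) 0.
  exists 0%N, (fun _ => 0), (fun _ _ => 0); rewrite !big_ord0; split=> //.
  by move=> y _; exact: dot0l.
split=> [zF|[zH zK] _ [x [y [xH [yK ->]]]]].
  split=> y yI; apply: zF.
    by exists y, 0; rewrite addr0; split=> //; split=> //; exact: im0.
  by exists 0, y; rewrite add0r; split=> //; exact: im0.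
by rewrite dotDr zH // zK // addr0.
Qed.

(** * The Fock space of the free product *)

Theorem proposition4p8 (R : realType)
    (H1 K1 : hilbert R) (finH1 : finite_dim H1) (finK1 : finite_dim K1)
    (TH : tensor_powers H1) (TK : tensor_powers K1)
    (H : forall n, set (TH n)) (K : forall n, set (TK n))
    (quadH : quadratic H) (quadK : quadratic K)
    (H1K1 : oplus H1 K1) (T : tensor_powers H1K1)
    (FH : fock H) (FK : fock K) (FHK : fock (free_subproduct T H K))
    (P : hilbert_free_product (fun b : bool =>
           if b then pointed_fock quadH FH else pointed_fock quadK FK)) :
  unitarily_isomorphic FHK P.
Proof.
have [m [u [gu eu]]] := finite_dim_onb finH1.
have [n [w [gw ew]]] := finite_dim_onb finK1.
pose frH := frame_left n gu eu.
pose frK := frame_right m gw ew.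
pose e := frame_sum gu gw eu ew H1K1.
have [RH HE] := quadratic_fibres quadH.
have [RK KE] := quadratic_fibres quadK.
(* the two systems as a family over bool *)
pose V (b : bool) := if b then H1 else K1.
pose TV b : tensor_powers (V b) :=
  if b return tensor_powers (if b then H1 else K1) then TH else TK.
pose Hb b : forall k, set (TV b k) := match b with true => H | false => K end.
pose fr b : frame (V b) ('I_m + 'I_n)%type :=
  if b return frame (if b then H1 else K1) ('I_m + 'I_n)%type then frH else frK.
have H2s b : is_subspace (Hb b 2%N).
  by case: b; [case: RH => Rel|case: RK => Rel]; rewrite /Hb => ->;
    exact: orthocompl_subspace.
have HbE b k : Hb b k = max_fiber (Hb b 2%N) k by case: b.
have fdom_fr b a : fdom (fr b) a = (sum_colour a == b) by case: b.
have fdom_e a : fdom e a by [].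
(* the fibres of the free product, by one-coloured slices *)
have ME k (z : T k) : free_subproduct T H K k z <->
    forall v v', (size v + 2 + size v' = k)%N ->
    forall b, Hb b 2%N (window (fr b) (TV b) (coef e z) v v').
  have F2 v v' : free_fiber2 T H K (window e T (coef e z) v v') <->
      forall b, Hb b 2%N (window (fr b) (TV b) (coef e z) v v').
    have wE (b : bool) : window (fr b) (TV b) (coef e z) v v' =
        of_coef (fr b) (TV b) 2 (coef e (window e T (coef e z) v v')).
      by apply: of_coef_ext => s s2; rewrite coef_of_coef.
    rewrite (free_fiber2P (e := e) _ (frame_sum_inl w gu eu H1K1)
      (frame_sum_inr u gw ew H1K1) RH RK).
    split=> [[zH zK] [] | h]; rewrite ?wE //.
    by split; [have := h true|have := h false]; rewrite wE.
  rewrite /free_subproduct max_fiberP; last exact: orthocompl_subspace.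
  by split=> h v v' vv; apply/F2; exact: h.
have basis b k : exists p : nat * (nat -> TV b k),
    [/\ forall i, (i < p.1)%N -> Hb b k (p.2 i),
      forall i j, (i < p.1)%N -> (j < p.1)%N -> '[p.2 i, p.2 j] = (i == j)%:R &
      forall x, Hb b k x -> x = \sum_(i < p.1) '[x, p.2 i] *: p.2 i].
  have Hs : is_subspace (Hb b k).
    by case: b; [have [[h _ _ _] _] := quadH|have [[h _ _ _] _] := quadK]; exact: h.
  by have [d [beta dP]] := tensor_onb (fr b) Hs; exists (d, beta).
pose d b k := (sval (cid (basis b k))).1.
pose beta b k := (sval (cid (basis b k))).2.
have bP b k := svalP (cid (basis b k)).
have b1 b k i : (i < d b k)%N -> Hb b k (beta b k i).
  by have [h _ _] := bP b k; exact: h.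
have b2 b k i j : (i < d b k)%N -> (j < d b k)%N ->
    '[beta b k i, beta b k j] = (i == j)%:R.
  by have [_ h _] := bP b k; exact: h.
have b3 b k x : Hb b k x -> x = \sum_(i < d b k) '[x, beta b k i] *: beta b k i.
  by have [_ _ h] := bP b k; exact: h.
pose E (b : bool) := if b then pointed_fock quadH FH else pointed_fock quadK FK.
pose eps b : nat * nat -> E b :=
  if b return nat * nat -> (if b then pointed_fock quadH FH else pointed_fock quadK FK)
  then fock_basis quadH FH (beta true) else fock_basis quadK FK (beta false).
have eps1 b j : basis_index d b j -> orthocompl [set ph_vec (E b)] (eps b j).
  case: b => jd; first exact: (@fock_basis_ortho R H1 TH H quadH FH (d true) (beta true) (b1 true) j jd).
  exact: (@fock_basis_ortho R K1 TK K quadK FK (d false) (beta false) (b1 false) j jd).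
have eps2 b i j : basis_index d b i -> basis_index d b j ->
    '[eps b i, eps b j] = (i == j)%:R.
  case: b => id jd; first exact: (@fock_basis_gram R H1 TH H quadH FH (d true) (beta true) (b1 true) (b2 true) i j id jd).
  exact: (@fock_basis_gram R K1 TK K quadK FK (d false) (beta false) (b1 false) (b2 false) i j id jd).
have eps3 b x : orthocompl [set ph_vec (E b)] x ->
    closed_span [set z | exists2 j, basis_index d b j & z = eps b j] x.
  case: b x => x xv.
    exact: (@fock_basis_total R H1 _ frH TH H quadH FH (d true) (beta true)
      (b1 true) (b3 true) x xv).
  exact: (@fock_basis_total R K1 _ frK TK K quadK FK (d false) (beta false)
    (b1 false) (b3 false) x xv).
apply: (@unitary_of_gram R FHK P _
  (@free_fock_basis R H1K1 _ e T V TV fr _ d beta FHK)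
  (@free_basis R E P d eps)).
- move=> l l'; rewrite (free_basis_gram _ eps1 eps2).
  exact: (free_fock_basis_gram fdom_e fdom_fr H2s HbE ME b1 b2).
- exact: (free_fock_basis_total fdom_e fdom_fr H2s HbE ME b1 b3).
- exact: (free_basis_total _ eps1 eps3).
Qed.
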